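(* Assume that $(A,B)$ is an attractor-repeller pair for a hybrid system $\mathcal{H}=(\Phi_C,G)$ on a compact metric space $X$, with associated relation $H$. There exists a continuous function $L: X \to [0,1]$ with $B = L^{-1}(0)$, $A = L^{-1}(1)$ and such that if $(x,y) \in (\phi_C)^I \cup \mathcal{C}H$ with $x \neq y$, then $L(y) \ge L(x)$ with equality only when $x,y \in A$ or $x,y \in B$. In particular, $L$ is a Lyapunov function for $\mathcal{C}H$ with $|L| = A \cup B$. Furthermore, for all $a$ such that $0 < a < 1$, the set $U_a = \{ x : L(x) \ge a \}$ is an inward subset for $\mathcal{H}$ with associated attractor $A$. If $V$ is any neighborhood of $A$, there exists $0 < a < 1$ such that $U_a \subset V$.
   Context: A relation on $X$ is a subset $R\subset X\times X$, closed if a closed subset; $R(x)=\{y:(x,y)\in R\}$, $R(A)=\bigcup_{x\in A}R(x)$, $R^{-1}=\{(y,x):(x,y)\in R\}$, $Q\circ R=\{(x,z):\exists y,\ (x,y)\in R,(y,z)\in Q\}$, $R^n$ the $n$-fold composition, $R^{-n}=(R^{-1})^n$. A semiflow relation on $X$ is a closed subset $\Phi\subset X\times[0,\infty)\times X$ such that, with $\phi^t=\{(x,y):(x,t,y)\in\Phi\}$: $\phi^0$ is the diagonal and $\phi^{t_1}\circ\phi^{t_2}=\phi^{t_1+t_2}$ for all $t_1,t_2\ge0$. For $C\subset X$ closed, $\Phi_C$ is the set of $(x,t,y)\in C\times[0,\infty)\times C$ such that there is $\mathbf{x}:[0,t]\to C$ with $\mathbf{x}(0)=x$, $\mathbf{x}(t)=y$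 and $(\mathbf{x}(s_1),s_2-s_1,\mathbf{x}(s_2))\in\Phi$ for all $0\le s_1<s_2\le t$. A hybrid dynamical system on $X$ is a pair $\mathcal{H}=(\Phi_C,G)$ with $\Phi$ a semiflow relation on $X$, $C$ a nonempty closed subset of $X$ and $G$ a closed relation on $X$. With $I=[0,1]$, $J=[1,2]$: $(\phi_C)^I=\{(x,x):x\in X\}\cup\{(x,y):(x,t,y)\in\Phi_C \text{ for some } t\in I\}$, $(\phi_C)^J=\{(x,y):(x,t,y)\in\Phi_C\text{ for some }t\in J\}$, $(\phi_C)^t=\{(x,y):(x,t,y)\in\Phi_C\}$ for $t>0$, and the associated relation is $H=((\phi_C)^I\circ G\circ(\phi_C)^I)\cup(\phi_C)^J$. $\mathcal{C}R=\bigcap_{\epsilon>0}\mathcal{O}(V_\epsilon\circ R)$ where $\mathcal{O}Q=\bigcup_{n\ge1}Q^n$, $V_\epsilon=\{(x,y):d(x,y)<\epsilon\}$. $(A,B)$ is an attractor-repeller pair for $\mathcal{H}$ if it is one for the closed relation $H$: there is a closed $U$ with $H(U)\subset U^\circ$, $A=\bigcap_{n\ge1}H^n(U)$ (the attractor associated with $U$) and $B=\bigcap_{n\ge1}H^{-n}(X\setminus U^\circ)$. A closed set $U$ is inward for $\mathcal{H}$ if $G(U)\subset U^\circ$ and $(\phi_C)^t(U)\subset U^\circ$ for all $t>0$; its associated attractor is $\bigcap_{n\ge1}H^n(U)$. A continuous $L:X\to\mathbb{R}$ is a Lyapunov function for $R$ if $(x,y)\in R$ implies $L(x)\le L(y)$.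 $|L|$ is the set of critical points of $L$ with respect to $R$ (here $R=\mathcal{C}H$), i.e. the points $x$ for which $\sup L|R^{-1}(x)<L(x)<\inf L|R(x)$ fails ($\sup\emptyset=-\infty$, $\inf\emptyset=\infty$). *)

(* Defs.v *)
From mathcomp Require Import all_boot all_order all_algebra.
From mathcomp Require Import all_classical all_reals all_analysis.

Set Implicit Arguments.
Unset Strict Implicit.
Unset Printing Implicit Defensive.

Import Order.TTheory GRing.Theory Num.Theory.
Import numFieldNormedType.Exports.

Local Open Scope classical_set_scope.
Local Open Scope ring_scope.

(* Relations on X are sets of pairs. [Q \; S] (relation_scope) is the usual
   composition "Q after S", i.e. {(x, z) : (x, y) in S and (y, z) in Q}, and
   [S^-1]%relation is the converse relation. *)

Section Relations.
Variable X : Type.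
Implicit Types (S : set (X * X)) (A : set X).
Local Open Scope relation_scope.

Definition rel_image S A : set X := [set y | exists2 x, A x & S (x, y)].

Fixpoint rel_iter S (n : nat) : set (X * X) :=
  if n is m.+1 then S \; rel_iter S m else diagonal.

Definition orbit_rel S : set (X * X) :=
  \bigcup_(n in [set n | (1 <= n)%N]) rel_iter S n.

Definition iter_limit S A : set X :=
  \bigcap_(n in [set n | (1 <= n)%N]) rel_image (rel_iter S n) A.

End Relations.

Section Dynamics.
Variables (R : realType) (X : metricType R).
Implicit Types (S : set (X * X)) (A B U C : set X) (Phi : set (X * R * X)).
Local Open Scope relation_scope.

Definition Veps (e : R) : set (X * X) := [set xy | mdist xy.1 xy.2 < e].

Definition chain_rel S : set (X * X) :=
  \bigcap_(e in [set e : R | 0 < e]) orbit_rel (Veps e \; S).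

Definition time_slice Phi (t : R) : set (X * X) :=
  [set xy | Phi (xy.1, t, xy.2)].

(* The time set [0, oo) is closed in R, so being closed in X * [0, oo) * X is
   the same as being closed in X * R * X and contained in X * [0, oo) * X. *)
Definition semiflow_relation Phi : Prop :=
  [/\ closed Phi,
      (forall x t y, Phi (x, t, y) -> 0 <= t),
      time_slice Phi 0 = diagonal &
      forall t1 t2, 0 <= t1 -> 0 <= t2 ->
        time_slice Phi t1 \; time_slice Phi t2 = time_slice Phi (t1 + t2)].

(* The path [0, t] -> C is the restriction to [0, t] of the total [p]. *)
Definition flow_restriction Phi C : set (X * R * X) :=
  [set w | let: (x, t, y) := w in
    [/\ C x, 0 <= t, C y &
     exists p : R -> X,
       [/\ (forall s, 0 <= s <= t -> C (p s)), p 0 = x, p t = y &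
        forall s1 s2, 0 <= s1 -> s1 < s2 -> s2 <= t ->
          Phi (p s1, s2 - s1, p s2)]]].

Record hybrid_system := HybridSystem {
  hybrid_flow : set (X * R * X) ;
  hybrid_flowP : semiflow_relation hybrid_flow ;
  hybrid_dom : set X ;
  hybrid_dom_closed : closed hybrid_dom ;
  hybrid_dom_neq0 : hybrid_dom !=set0 ;
  hybrid_jump : set (X * X) ;
  hybrid_jump_closed : closed hybrid_jump
}.

Implicit Type H : hybrid_system.

Definition hybrid_flowC H : set (X * R * X) :=
  flow_restriction (hybrid_flow H) (hybrid_dom H).

Definition phiC H (t : R) : set (X * X) := time_slice (hybrid_flowC H) t.

Definition phiC_I H : set (X * X) :=
  diagonal `|` \bigcup_(t in `[0, 1]) phiC H t.

Definition phiC_J H : set (X * X) := \bigcup_(t in `[1, 2]) phiC H t.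

Definition hybrid_rel H : set (X * X) :=
  (phiC_I H \; (hybrid_jump H \; phiC_I H)) `|` phiC_J H.

Definition attractor_repeller_pair S A B : Prop :=
  exists U, [/\ closed U, rel_image S U `<=` interior U,
    A = iter_limit S U & B = iter_limit (S^-1) (~` interior U)].

Definition hybrid_attractor_repeller_pair H A B : Prop :=
  attractor_repeller_pair (hybrid_rel H) A B.

Definition inward H U : Prop :=
  [/\ closed U, rel_image (hybrid_jump H) U `<=` interior U &
      forall t : R, 0 < t -> rel_image (phiC H t) U `<=` interior U].

Definition associated_attractor H U : set X := iter_limit (hybrid_rel H) U.

Definition Lyapunov_function S (L : X -> R) : Prop :=
  continuous L /\ forall x y, S (x, y) -> L x <= L y.

(* Suprema and infima are taken in the extended reals, where
   sup set0 = -oo and inf set0 = +oo. *)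
Definition critical_points S (L : X -> R) : set X :=
  [set x | ~ ((ereal_sup [set (L y)%:E | y in [set y | S (y, x)]] < (L x)%:E)%E
           /\ ((L x)%:E < ereal_inf [set (L y)%:E | y in [set y | S (x, y)]])%E)].

End Dynamics.

(* Main.v *)
Require Import Defs.
From HB Require Import structures.
From mathcomp Require Import all_boot all_order all_algebra.
From mathcomp Require Import all_classical all_reals all_analysis.
From mathcomp Require Import lra.

(** Let H be the relation of the hybrid system, CH its chain relation and
phi_I the flow over times in [0, 1].  The function L comes from an order: the
relation K := phi_I `|` CH is a closed preorder on X, and L is a continuous
function that is monotone for K, takes the value 1 exactly on A and 0 exactly
on B, and separates strictly the pairs of K that K does not identify.

K is reflexive because phi_I contains the diagonal.  It is transitive because
following a flow line of length at most 1 after, or before, a step of H gives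
at most two steps of H ([hybrid_rel_phiC_I], [phiC_I_hybrid_rel]), and because
a chain of a closed relation on a compact space can be taken to start and to
end with an exact step ([chain_rel_first], [chain_rel_last]).  It is closed
because chain relations are closed ([closed_chain_rel]) and because a limit of
flow lines inside C is a flow line inside C ([closed_flow_restriction]: after
rescaling the flow lines to [0, 1], take pointwise limits along an
ultrafilter).

The attractor A is the largest subset D of the trapping set with D contained
in H(D) ([sub_iter_limit], [iter_limit_pred]); the repeller is the same object
for the inverse of H and the complement.  With this description A is closed
upwards and B downwards for K, and every chain recurrent point lies in A or in
B ([chain_recurrent_attractor_repeller]).  Two distinct points identified by K
are chain recurrent, since a flow line that returns can be followed long enough
to be cut into steps of H.  Hence outside A and B the preorder is a partial order, and
strict monotonicity on the pairs that K does not identify is exactly the strict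
increase that L must have.

The function is built as for compact ordered spaces (Nachbin).  A closed upward
closed set has arbitrarily small closed upward closed neighbourhoods
([increasing_nbhs]), so the construction of Urysohn yields monotone separating
functions ([monotone_urysohn]); a countable base of X reduces the conditions of
strictness to countably many, and a dyadically weighted mean of the
corresponding functions satisfies all of them ([exists_strict_separator]).

The remaining properties of L follow.  A point outside A and B is not related
to itself by CH, so by compactness the supremum of L over its predecessors and
the infimum over its successors are attained and strict, while every point of A
has a predecessor in A and every point of B a successor in B.  For the
superlevel set U_a, the minimum of L over the attractor associated with U_a is
reached at a point that has a predecessor in the same set; L cannot increase
along that step, so the minimum is 1. *)

Set Implicit Arguments.
Unset Strict Implicit.
Unset Printing Implicit Defensive.

Import Order.TTheory GRing.Theory Num.Theory.
Import numFieldNormedType.Exports.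

Local Open Scope classical_set_scope.
Local Open Scope ring_scope.

(** * Compactness in metric spaces *)

Section CompactTools.

(** The tube lemma: if the compact fibre over a point avoids S, so do the fibres
over all nearby points. *)
Lemma closed_proj (T1 T2 : topologicalType) (K : set T2) (S : set (T1 * T2)) :
  compact K -> closed S -> closed [set x | exists2 y, K y & S (x, y)].
Proof.
move=> /compact_near_coveringP cK cS x; apply: contraPP => nx.
have : \forall x' \near x, K `<=` [set y | ~ S (x', y)].
  apply: (cK _ (nbhs x) (fun x' y => ~ S (x', y))) => y Ky.
  have : nbhs (x, y) (~` S).
    apply: open_nbhs_nbhs; split; first exact: closed_openC.
    by move=> Sxy; apply: nx; exists y.
  by case=> -[V W] /= [Vx Wy] VW; exists (W, V) => // -[y' x'] [/= ? ?]; apply: VW.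
move=> h clx; have [x' [[y Ky Sy] nS]] := clx _ h.
exact: nS Ky Sy.
Qed.

(** The finite intersection property for a downward directed family of nonempty
sets; closures appear so that the members need not be closed. *)
Lemma compact_cluster_family (T : topologicalType) (I : Type) (D : set I)
    (Q : I -> set T) : compact [set: T] ->
  D !=set0 ->
  (forall i j, D i -> D j -> exists2 k, D k & Q k `<=` Q i `&` Q j) ->
  (forall i, D i -> Q i !=set0) ->
  exists z, forall i, D i -> closure (Q i) z.
Proof.
move=> cT [i0 Di0] Qdir Q0.
have FF : Filter (filter_from D Q) by apply: filter_from_filter => //; exists i0.
have PF : ProperFilter (filter_from D Q) by exact: filter_from_proper.
have [z [_ clz]] := cT _ PF filterT.
by exists z => i Di V Vz; apply: clz => //; exists i.
Qed.

Context {R : realType} {X : metricType R}.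

Lemma metric_closureP (A : set X) x :
  closure A x <-> forall e : R, 0 < e -> exists2 y, A y & mdist x y < e.
Proof.
split=> [clx e e0|h V].
  have [y [Ay]] := clx _ (nbhsx_ballx x e e0).
  by rewrite ballEmdist /= => ?; exists y.
move=> /nbhs_ballP [e /= e0 xV]; have [y Ay xy] := h _ e0.
by exists y; split => //; apply: xV; rewrite ballEmdist.
Qed.

Lemma metric_closed_relP (S : set (X * X)) : closed S <->
  forall x y, (forall e : R, 0 < e ->
    exists x' y', [/\ mdist x x' < e, mdist y y' < e & S (x', y')]) -> S (x, y).
Proof.
split=> [cS x y h|h [x y] clxy].
  apply: cS => V /nbhs_ballP [e /= e0 xyV].
  have [x' [y' [xx' yy' Sxy]]] := h _ e0.
  by exists (x', y'); split => //; apply: xyV; split; rewrite /= ballEmdist.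
apply: h => e e0.
have /clxy [[x' y'] [Sxy [/=]]] : nbhs (x, y) (ball (x, y) e) by exact: nbhsx_ballx.
by rewrite !ballEmdist => ? ?; exists x', y'.
Qed.

(** This replaces the extraction of a convergent subsequence: [Q e] holds of the
data that are correct up to the error e, and z is a limit of such data as e
tends to 0. *)
Lemma metric_cluster (Q : R -> set X) : compact [set: X] ->
  (forall e e' : R, 0 < e -> e <= e' -> Q e `<=` Q e') ->
  (forall e : R, 0 < e -> Q e !=set0) ->
  exists z, forall e : R, 0 < e -> exists2 z', Q e z' & mdist z z' < e.
Proof.
move=> cX Qmono Q0.
have [z zP] : exists z, forall e : R, [set e | 0 < e] e -> closure (Q e) z.
  apply: compact_cluster_family => //; first by exists 1 => /=.
  move=> e e' /= e0 e'0; exists (Num.min e e') => /=; first by rewrite lt_min e0.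
  by move=> x Qx; split; apply: Qmono Qx; rewrite ?lt_min ?e0 // ge_min lexx ?orbT.
by exists z => e e0; have /metric_closureP := zP e e0; exact.
Qed.

End CompactTools.

Section HalfPowers.
Context {R : realType}.

Lemma half_exp_cvg0 : 2^-1 ^+ n @[n --> \oo] --> (0 : R).
Proof. by apply: cvg_expr; rewrite ger0_norm ?invr_ge0// invf_lt1// ltr1n. Qed.

Lemma half_exp_lt (e : R) : 0 < e -> exists N, 2^-1 ^+ N < e.
Proof.
move=> e0; have /cvgrPdist_lt /(_ e e0) [n _ /(_ n (leqnn n))] /= := half_exp_cvg0.
by rewrite sub0r normrN ger0_norm ?exprn_ge0 ?invr_ge0//; exists n.
Qed.

End HalfPowers.

(** * Limits of iterated images *)

Section IterLimit.
Context {R : realType} {X : metricType R}.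
Hypothesis cX : compact [set: X].
Implicit Types (S : set (X * X)) (A B D U : set X).

Lemma rel_image_iterS S n U :
  rel_image (rel_iter S n.+1) U = rel_image S (rel_image (rel_iter S n) U).
Proof.
apply/seteqP; split=> y.
  by move=> [x Ux [z /= xz zy]]; exists z => //; exists x.
by move=> [z [x Ux xz] zy]; exists x => //; exists z.
Qed.

Lemma rel_image_iter0 S U : rel_image (rel_iter S 0) U = U.
Proof.
apply/seteqP; split=> [y [x Ux /= /diagonalP <-] //|y Uy].
by exists y.
Qed.

Lemma closed_rel_image S A : closed S -> closed A -> closed (rel_image S A).
Proof.
move=> cS cA.
have -> : rel_image S A = [set y | exists2 x, A x & [set p | S (p.2, p.1)] (y, x)].
  by [].
apply: closed_proj; first exact: (subclosed_compact cA cX).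
apply: (closed_comp (f := fun p : X * X => (p.2, p.1))) => // p _.
by apply: cvg_pair; [exact: cvg_snd | exact: cvg_fst].
Qed.

Lemma closed_rel_section S y : closed S -> closed [set x | S (x, y)].
Proof.
move=> cS; apply: (closed_comp (f := fun x => (x, y))) => // p _.
by apply: cvg_pair; [exact: cvg_id | exact: cvg_cst].
Qed.

Lemma closed_rel_inv S : closed S -> closed (S^-1)%relation.
Proof.
move=> cS; apply: (closed_comp (f := fun p : X * X => (p.2, p.1))) => // p _.
by apply: cvg_pair; [exact: cvg_snd | exact: cvg_fst].
Qed.

Lemma closed_rel_iter_image S n U :
  closed S -> closed U -> closed (rel_image (rel_iter S n) U).
Proof.
move=> cS cU; elim: n => [|n IH]; first by rewrite rel_image_iter0.
by rewrite rel_image_iterS; exact: closed_rel_image.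
Qed.

Lemma rel_iter_image_dec S U n : rel_image S U `<=` U ->
  rel_image (rel_iter S n.+1) U `<=` rel_image (rel_iter S n) U.
Proof.
move=> SU; elim: n => [|n IH]; first by rewrite rel_image_iterS rel_image_iter0.
move=> y; rewrite rel_image_iterS => -[x /IH Ux xy].
by rewrite rel_image_iterS; exists x.
Qed.

Lemma closed_iter_limit S U : closed S -> closed U -> closed (iter_limit S U).
Proof. by move=> cS cU; apply: closed_bigI => n _; exact: closed_rel_iter_image. Qed.

Lemma iter_limit_sub S U : iter_limit S U `<=` rel_image S U.
Proof. by move=> y /(_ 1%N isT); rewrite rel_image_iterS rel_image_iter0. Qed.

(** With [iter_limit_pred] this says that, for a closed S that maps the closed set
U into itself, [iter_limit S U] is the largest subset D of U such that every
point of D has an S-predecessor in D. *)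
Lemma sub_iter_limit S U D : D `<=` U ->
  (forall y, D y -> exists2 x, D x & S (x, y)) -> D `<=` iter_limit S U.
Proof.
move=> DU Dpred y Dy n _; elim: n y Dy => [|n IH] y Dy.
  by rewrite rel_image_iter0; exact: DU.
by rewrite rel_image_iterS; have [x Dx xy] := Dpred _ Dy; exists x => //; exact: IH.
Qed.

(** Since y lies in every iterated image, for every n it has a predecessor in the
n-th one; these sets of predecessors are closed and decrease with n. *)
Lemma iter_limit_pred S U : closed S -> closed U -> rel_image S U `<=` U ->
  forall y, iter_limit S U y -> exists2 x, iter_limit S U x & S (x, y).
Proof.
move=> cS cU SU y Uy.
pose Q n := rel_image (rel_iter S n) U `&` [set x | S (x, y)].
have Qdec n m : (n <= m)%N -> Q m `<=` Q n.
  move=> /subnK <-; elim: (m - n)%N => // k IH x [Ux xy].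
  by apply: IH; split => //; rewrite addSn in Ux; exact: rel_iter_image_dec Ux.
have [z zP] : exists z, forall n, setT n -> closure (Q n) z.
  apply: compact_cluster_family => //.
  - move=> i j _ _; exists (maxn i j) => // x Qx.
    by split; apply: Qdec Qx; rewrite ?leq_maxl ?leq_maxr.
  - move=> n _; have := Uy n.+1 isT; rewrite rel_image_iterS => -[x Ux xy].
    by exists x.
have {}zP n : Q n z.
  suff cQ : closed (Q n) by exact: cQ (zP n I).
  by apply: closedI; [exact: closed_rel_iter_image | exact: closed_rel_section].
by exists z; [move=> n _; exact: (zP n).1 | exact: (zP 0%N).2].
Qed.

End IterLimit.

(** * The chain relation of a closed relation *)

Section Orbit.
Context {X : Type}.
Implicit Types (S : set (X * X)).

Lemma rel_iterD S m n x y z :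
  rel_iter S m (x, y) -> rel_iter S n (y, z) -> rel_iter S (m + n) (x, z).
Proof.
move=> xy; elim: n z => [|n IH] z /=; first by rewrite addn0 => /diagonalP <-.
by rewrite addnS => -[w /= yw wz]; exists w => //; exact: IH.
Qed.

Lemma sub_orbit_rel S : S `<=` orbit_rel S.
Proof. by move=> [x y] xy; exists 1%N => //=; exists x. Qed.

Lemma orbit_rel_trans S x y z :
  orbit_rel S (x, y) -> orbit_rel S (y, z) -> orbit_rel S (x, z).
Proof.
move=> [m m1 xy] [n n1 yz]; exists (m + n)%N; first by rewrite /= addn_gt0 m1.
exact: rel_iterD xy yz.
Qed.

Lemma orbit_rel_last S x y : orbit_rel S (x, y) ->
  exists2 z, x = z \/ orbit_rel S (x, z) & S (z, y).
Proof.
move=> [[//|n] _ [z /= xz zy]]; exists z => //.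
by case: n xz => [/diagonalP|n xz]; [left | right; exists n.+1].
Qed.

Lemma orbit_rel_ind S (P : X -> Prop) x y :
  (forall z w, P z -> S (z, w) -> P w) -> P x -> orbit_rel S (x, y) -> P y.
Proof.
move=> PS Px [n _]; elim: n y => [|n IH] y /=; first by move=> /diagonalP <-.
by move=> [z /= /IH Pz zy]; exact: PS Pz zy.
Qed.

Lemma orbit_rel_first S x y : orbit_rel S (x, y) ->
  exists2 z, S (x, z) & z = y \/ orbit_rel S (z, y).
Proof.
move=> [[//|n] _]; elim: n y => [|n IH] y /=.
  by move=> [_ /= /diagonalP <- xy]; exists y => //; left.
move=> [z /= /IH [w xw wz] zy]; exists w => //; right.
case: wz => [->|wz]; first exact: sub_orbit_rel.
by apply: orbit_rel_trans wz _; exact: sub_orbit_rel.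
Qed.

Lemma orbit_rel_mono S T : S `<=` T -> orbit_rel S `<=` orbit_rel T.
Proof.
move=> ST [x y] xy; have [z xz zy] := orbit_rel_first xy.
have Txz : orbit_rel T (x, z) by exact/sub_orbit_rel/ST.
case: zy => [<- //|].
apply: (orbit_rel_ind (P := fun w => orbit_rel T (x, w))) Txz => w v xw wv.
by apply: orbit_rel_trans xw _; exact/sub_orbit_rel/ST.
Qed.

End Orbit.

Section Chain.
Context {R : realType} {X : metricType R}.
Implicit Types (S : set (X * X)) (x y z : X) (e d : R).

Local Notation step e S := (Veps e \; S)%relation.

Lemma orbit_step_mono S e e' : e <= e' ->
  orbit_rel (step e S) `<=` orbit_rel (step e' S).
Proof.
move=> ee'; apply: orbit_rel_mono => -[x y] [z xz zy]; exists z => //.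
exact: lt_le_trans zy ee'.
Qed.

(** Moving the endpoint of a chain only enlarges its last error. *)
Lemma orbit_step_nudge S e d x y y' : 0 <= d -> orbit_rel (step e S) (x, y) ->
  mdist y y' < d -> orbit_rel (step (e + d) S) (x, y').
Proof.
move=> d0 xy yy'; have [z xz [w /= zw wy]] := orbit_rel_last xy.
have zy' : step (e + d) S (z, y').
  exists w => //=; rewrite /Veps /= (le_lt_trans (metric_triangle w y y'))//.
  exact: ltrD.
case: xz => [->|xz]; first by apply: sub_orbit_rel.
apply: (orbit_rel_trans (y := z)) (sub_orbit_rel zy').
by apply: orbit_step_mono xz; rewrite lerDl.
Qed.

Lemma sub_chain_rel S : S `<=` chain_rel S.
Proof.
move=> [x y] xy e /= e0; apply: sub_orbit_rel; exists y => //=.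
by rewrite /Veps /= mdistxx.
Qed.

Lemma chain_rel_trans S x y z :
  chain_rel S (x, y) -> chain_rel S (y, z) -> chain_rel S (x, z).
Proof. by move=> xy yz e e0; apply: orbit_rel_trans (xy e e0) (yz e e0). Qed.

Hypothesis cX : compact [set: X].

(** The endpoint of a chain can be moved freely, but not the starting point, as
nearby points may have no nearby successors.  In the limit, however, the first
exact successors v of the points x' accumulate at a successor of x, because S
is closed, and the discrepancy is absorbed in the first error. *)
Lemma chain_rel_lim S x y : closed S ->
  (forall e, 0 < e -> exists x' y', [/\ mdist x x' < e, mdist y y' < e &
     orbit_rel (step e S) (x', y')]) -> chain_rel S (x, y).
Proof.
move=> /metric_closed_relP cS xy.
pose Q e v := exists x' y' u, [/\ mdist x x' < e, mdist y y' < e, S (x', v),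
  mdist v u < e & u = y' \/ orbit_rel (step e S) (u, y')].
have [v vP] : exists v, forall e : R, 0 < e -> exists2 v', Q e v' & mdist v v' < e.
  apply: metric_cluster => // [e e' e0 ee' v|e /xy].
    move=> [x' [y' [u [xx' yy' x'v vu uy']]]]; exists x', y', u; split => //.
    - exact: lt_le_trans xx' ee'.
    - exact: lt_le_trans yy' ee'.
    - exact: lt_le_trans vu ee'.
    - by case: uy' => [|uy']; [left | right; exact: orbit_step_mono ee' _ uy'].
  move=> [x' [y' [xx' yy' x'y']]]; have [u [v /= x'v vu] uy'] := orbit_rel_first x'y'.
  by exists v, x', y', u.
have Sxv : S (x, v).
  apply: cS => e e0; have [v' [x' [y' [u []]]]] := vP e e0.
  by move=> xx' _ x'v' _ _ vv'; exists x', v'.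
move=> e /= e0; have e30 : 0 < e / 3 by rewrite divr_gt0.
have [v' [x' [y' [u [_ yy' _ vu uy']]]] vv'] := vP _ e30.
have {v' vu vv'} vu : mdist v u < e / 3 + e / 3.
  by rewrite (le_lt_trans (metric_triangle v v' u))// ltrD.
case: uy' => [uy'|uy'].
  apply: sub_orbit_rel; exists v => //=; rewrite /Veps /=.
  rewrite (le_lt_trans (metric_triangle v u y))// uy' [mdist y' y]metric_sym.
  by rewrite -uy'; move: yy' vu; rewrite uy'; lra.
apply: (orbit_rel_trans (y := u)).
  by apply: sub_orbit_rel; exists v => //=; rewrite /Veps /=; move: vu; lra.
apply: (orbit_step_mono (e := e / 3 + e / 3)); first lra.
by apply: orbit_step_nudge uy' _; [exact: ltW | rewrite metric_sym].
Qed.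

Lemma closed_chain_rel S : closed S -> closed (chain_rel S).
Proof.
move=> cS; apply/metric_closed_relP => x y xy; apply: chain_rel_lim => // e e0.
by have [x' [y' [xx' yy' x'y']]] := xy e e0; exists x', y'; split => //; exact: x'y'.
Qed.

(** As the errors tend to 0, the last step of the chains tends to an exact step
that ends at y. *)
Lemma chain_rel_last S x y : closed S -> chain_rel S (x, y) ->
  exists2 z, x = z \/ chain_rel S (x, z) & S (z, y).
Proof.
move=> cS xy; have /metric_closed_relP cS2 := cS.
pose Q e z := exists2 w, S (z, w) /\ mdist y w < e &
  x = z \/ orbit_rel (step e S) (x, z).
have [z zP] : exists z, forall e : R, 0 < e -> exists2 z', Q e z' & mdist z z' < e.
  apply: metric_cluster => // [e e' e0 ee' z|e e0].
    move=> [w [zw yw] xz]; exists w; first by split => //; exact: lt_le_trans yw ee'.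
    by case: xz => [|xz]; [left | right; exact: orbit_step_mono ee' _ xz].
  have [z xz [w /= zw wy]] := orbit_rel_last (xy e e0).
  by exists z, w => //; split => //; rewrite metric_sym.
exists z; last first.
  apply: cS2 => e e0; have [z' [w [z'w yw] _] zz'] := zP e e0.
  by exists z', w.
have [|xz] := pselect (x = z); [by left|right; apply: chain_rel_lim => // e e0].
have xz0 : 0 < mdist x z by rewrite mdist_gt0; exact/eqP.
pose d := Num.min e (mdist x z); have d0 : 0 < d by rewrite lt_min e0.
have [z' [w _ [xz'|xz']] zz'] := zP d d0.
  by move: zz'; rewrite -xz' metric_sym lt_min ltxx andbF.
exists x, z'; split; first by rewrite mdistxx.
  by apply: lt_le_trans zz' _; rewrite ge_min lexx.
by apply: orbit_step_mono xz'; rewrite ge_min lexx.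
Qed.

(** The first steps are exact already; they accumulate at some (x, z) in S, and
[chain_rel_lim] turns the remaining chains from points near z into a chain
from z. *)
Lemma chain_rel_first S x y : closed S -> chain_rel S (x, y) ->
  exists2 z, S (x, z) & z = y \/ chain_rel S (z, y).
Proof.
move=> cS xy; have /metric_closed_relP cS2 := cS.
pose Q e z := exists2 u, S (x, z) /\ mdist z u < e &
  u = y \/ orbit_rel (step e S) (u, y).
have [z zP] : exists z, forall e : R, 0 < e -> exists2 z', Q e z' & mdist z z' < e.
  apply: metric_cluster => // [e e' e0 ee' z|e e0].
    move=> [u [xz zu] uy]; exists u; first by split => //; exact: lt_le_trans zu ee'.
    by case: uy => [|uy]; [left | right; exact: orbit_step_mono ee' _ uy].
  by have [u [z /= xz zu] uy] := orbit_rel_first (xy e e0); exists z, u.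
exists z.
  apply: cS2 => e e0; have [z' [u [xz' _] _] zz'] := zP e e0.
  by exists x, z'; rewrite mdistxx.
have [|zy] := pselect (z = y); [by left|right; apply: chain_rel_lim => // e e0].
have zy0 : 0 < mdist z y by rewrite mdist_gt0; exact/eqP.
pose d := Num.min e (mdist z y); have d0 : 0 < d by rewrite lt_min e0.
have [z' [u [_ z'u] uy] zz'] := zP (d / 2) (divr_gt0 d0 (ltr0Sn R 1)).
have {z'u zz'} zu : mdist z u < d.
  by rewrite (le_lt_trans (metric_triangle z z' u))// [d]splitr ltrD.
case: uy => [uy|uy]; first by move: zu; rewrite uy lt_min ltxx andbF.
exists u, y; split; [|by rewrite mdistxx|].
  by apply: lt_le_trans zu _; rewrite ge_min lexx.
apply: orbit_step_mono uy; apply: (@le_trans _ _ d).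
  by rewrite ler_pdivrMr// ler_peMr ?ler1n// ltW.
by rewrite ge_min lexx.
Qed.

End Chain.

(** * Attractor-repeller pairs and chains *)

Section AttractorRepeller.
Context {R : realType} {X : metricType R}.
Hypothesis cX : compact [set: X].
Variable S : set (X * X).
Hypothesis cS : closed S.

(** By compactness there is e such that the e-neighbourhood of S(U) lies in U, so
the e-chains that start in U never leave it; an exact last step puts the end
in S(U). *)
Lemma chain_rel_trapped (U : set X) x y : closed U ->
  rel_image S U `<=` interior U -> U x -> chain_rel S (x, y) -> rel_image S U y.
Proof.
move=> cU SU Ux xy.
have [e e0 eU] : exists2 e : R, 0 < e &
    forall w z, rel_image S U w -> mdist w z < e -> U z.
  apply: contrapT => no.
  pose Q e w := rel_image S U w /\ exists2 z, mdist w z < e & ~ U z.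
  have [w wP] : exists w, forall e : R, 0 < e -> exists2 w', Q e w' & mdist w w' < e.
    apply: metric_cluster => // [e e' e0 ee' w [SUw [z wz nUz]]|e e0].
      by split => //; exists z => //; exact: lt_le_trans wz ee'.
    apply: contrapT => nQ; apply: no; exists e => // w z SUw wz.
    by apply: contrapT => nUz; apply: nQ; exists w; split => //; exists z.
  have SUw : rel_image S U w.
    apply: (closed_rel_image cX cS cU); apply/metric_closureP => e /wP [w' [SUw' _] ww'].
    by exists w'.
  have /nbhs_ballP [e /= e0 wU] := SU _ SUw.
  have [w' [_ [z w'z nUz]] ww'] := wP (e / 2) (divr_gt0 e0 (ltr0Sn R 1)).
  apply: nUz; apply: wU; rewrite ballEmdist /= (le_lt_trans (metric_triangle w w' z))//.
  by rewrite [e]splitr ltrD.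
have [z xz zy] := chain_rel_last cX cS xy; exists z => //.
case: xz => [<- //|xz]; move: (xz e e0); apply: orbit_rel_ind Ux => u v Uu [w /= uw wv].
by apply: eU wv; exists u.
Qed.

Variables A B : set X.
Hypothesis hAB : attractor_repeller_pair S A B.

Let trap := sval (cid hAB).
Let trapP : [/\ closed trap, rel_image S trap `<=` interior trap,
    A = iter_limit S trap & B = iter_limit (S^-1)%relation (~` interior trap)] :=
  svalP (cid hAB).

Let closed_trap : closed trap. Proof. by case: trapP. Qed.
Let trap_inward : rel_image S trap `<=` interior trap. Proof. by case: trapP. Qed.
Let AE : A = iter_limit S trap. Proof. by case: trapP. Qed.
Let BE : B = iter_limit (S^-1)%relation (~` interior trap). Proof. by case: trapP. Qed.

Let closed_cotrap : closed (~` interior trap).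
Proof. exact/open_closedC/open_interior. Qed.

Let trap_sub : rel_image S trap `<=` trap.
Proof. by move=> x /trap_inward /interior_subset. Qed.

Let cotrap_sub : rel_image (S^-1)%relation (~` interior trap) `<=` ~` interior trap.
Proof.
move=> x [y ny xy] /interior_subset Ux; apply: ny; apply: trap_inward.
by exists x.
Qed.

Let A_sub : A `<=` interior trap.
Proof. by rewrite AE => x /iter_limit_sub /trap_inward. Qed.

Let B_sub : B `<=` ~` interior trap.
Proof. by rewrite BE => x /iter_limit_sub /cotrap_sub. Qed.

Lemma attractor_closed : closed A.
Proof. by rewrite AE; exact: closed_iter_limit. Qed.

Lemma repeller_closed : closed B.
Proof. by rewrite BE; apply: closed_iter_limit => //; exact: closed_rel_inv. Qed.

Lemma attractor_repeller_disjoint x : A x -> B x -> False.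
Proof. by move=> /A_sub Ux /B_sub. Qed.

Lemma attractor_pred y : A y -> exists2 x, A x & S (x, y).
Proof. by rewrite AE; exact: iter_limit_pred. Qed.

Lemma repeller_succ x : B x -> exists2 y, B y & S (x, y).
Proof.
by rewrite BE => /iter_limit_pred; apply => //; exact: closed_rel_inv.
Qed.

(** A together with the chain successors of x stays in the trapping set, and each
of its points has a predecessor in it, so it is contained in the largest such
set, which is A. *)
Lemma chain_rel_attractor x y : A x -> chain_rel S (x, y) -> A y.
Proof.
move=> Ax xy; rewrite AE.
apply: (sub_iter_limit (D := A `|` [set z | chain_rel S (x, z)])); last by right.
  move=> z [/A_sub/interior_subset //|xz].
  apply: trap_sub; apply: chain_rel_trapped (xz) => //.
  exact: interior_subset (A_sub Ax).
move=> z [/attractor_pred[w Aw wz]|/(chain_rel_last cX cS) [w xw wz]].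
  by exists w => //; left.
by exists w => //; case: xw => [<-|]; [left | right].
Qed.

Let chain_rel_cotrap x y :
  ~ interior trap y -> chain_rel S (x, y) -> ~ interior trap x.
Proof.
move=> ny xy /interior_subset Ux; apply/ny/trap_inward.
exact: chain_rel_trapped xy.
Qed.

(** Dual to [chain_rel_attractor], with exact first steps: a chain that enters the
interior of the trapping set cannot leave it, so the chain predecessors of y
stay outside. *)
Lemma chain_rel_repeller x y : B y -> chain_rel S (x, y) -> B x.
Proof.
move=> By xy; rewrite BE.
apply: (sub_iter_limit (D := B `|` [set z | chain_rel S (z, y)])); last by right.
  by move=> z [/B_sub //|/=]; exact/chain_rel_cotrap/B_sub.
move=> z [/repeller_succ[w Bw zw]|/(chain_rel_first cX cS) [w zw wy]].
  by exists w => //; left.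
by exists w => //; case: wy => [->|]; [left | right].
Qed.

(** A recurrent point is its own chain predecessor, so every point of the set of
its chain successors has a predecessor in that set; if x is in the
interior of the trapping set, this set lies in A.  Otherwise the chain predecessors of x avoid the
interior of the trapping set and form a subset of B. *)
Lemma chain_recurrent_attractor_repeller x : chain_rel S (x, x) -> A x \/ B x.
Proof.
move=> xx; have [Ux|nUx] := pselect (interior trap x); [left|right].
  rewrite AE; apply: (sub_iter_limit (D := [set z | chain_rel S (x, z)])) => //.
    move=> z xz; apply: trap_sub; apply: chain_rel_trapped xz => //.
    exact: interior_subset.
  move=> z /(chain_rel_last cX cS) [w xw wz]; exists w => //.
  by case: xw => [<-|].
rewrite BE; apply: (sub_iter_limit (D := [set z | chain_rel S (z, x)])) => //.
  by move=> z; exact: chain_rel_cotrap.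
move=> z /(chain_rel_first cX cS) [w zw wx]; exists w => //.
by case: wx => [->|].
Qed.

End AttractorRepeller.

(** * A Urysohn function for an interpolating family of closed sets *)

Section DyadicUrysohn.
Context {R : realType} {T : topologicalType}.
Variable P : set (set T).
Hypothesis P_closed : forall F, P F -> closed F.
Hypothesis P_setT : P setT.
Hypothesis P_interp : forall F W, P F -> P W -> F `<=` interior W ->
  exists M, [/\ P M, F `<=` interior M & M `<=` interior W].

(** The hypotheses are moved under the existential so that the chosen interpolant
is a total function of F and W. *)
Let interp (F W : set T) : exists M, P F -> P W -> F `<=` interior W ->
  [/\ P M, F `<=` interior M & M `<=` interior W].
Proof.
have [[PF PW FW]|no] := pselect [/\ P F, P W & F `<=` interior W].
  by have [M MP] := P_interp PF PW FW; exists M.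
by exists set0 => PF PW FW; case: no.
Qed.

Let mid F W := sval (cid (interp F W)).

Variables F W : set T.
Hypotheses (PF : P F) (PW : P W) (FW : F `<=` interior W).

(** [dyadic_set n k] plays the role of the sublevel set at height k / 2^n of the
function under construction.  The level n = 0 is F, W and then the whole space, so that
the heights range over [0, 2]; each further level inserts interpolants. *)
Fixpoint dyadic_set n k : set T :=
  if n is m.+1 then
    if odd k then mid (dyadic_set m k./2) (dyadic_set m k./2.+1)
    else dyadic_set m k./2
  else match k with 0 => F | 1 => W | _ => setT end.

Lemma dyadic_set_step n k :
  P (dyadic_set n k) /\ dyadic_set n k `<=` interior (dyadic_set n k.+1).
Proof.
elim: n k => [|n IH] k.
  by case: k => [|[|k]] /=; rewrite ?interiorT //; split => //; rewrite interiorT.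
have [PD Dsub] := IH k./2; have [PD' _] := IH k./2.+1.
have [PM DM MD] := svalP (cid (interp _ _)) PD PD' Dsub.
rewrite /= uphalf_half; case: (odd k) => /=; last by rewrite add0n.
by rewrite add1n.
Qed.

Lemma dyadic_set_refine m n k : dyadic_set (m + n) (2 ^ m * k) = dyadic_set n k.
Proof.
elim: m => [|m IH]; first by rewrite expn0 mul1n.
by rewrite addSn /= expnS -mulnA mul2n odd_double doubleK.
Qed.

Lemma dyadic_set_mono n k l : (k <= l)%N -> dyadic_set n k `<=` dyadic_set n l.
Proof.
move=> /subnK <-; elim: (l - k)%N => // j IH x /IH.
by have [_ Dsub] := dyadic_set_step n (j + k); move=> /Dsub/interior_subset.
Qed.

Lemma dyadic_set_top n : dyadic_set n (2 ^ n * 2) = setT.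
Proof. by have := dyadic_set_refine n 0 2; rewrite addn0. Qed.

Definition dyadic_values x : set R :=
  [set r | exists n k, dyadic_set n k x /\ r = k%:R / 2 ^+ n].

Definition dyadic_height x : R := inf (dyadic_values x).

Lemma dyadic_values_lbound x : lbound (dyadic_values x) 0.
Proof. by move=> _ [n [k [_ ->]]]; rewrite divr_ge0 ?exprn_ge0. Qed.

Lemma dyadic_values_neq0 x : dyadic_values x !=set0.
Proof. by exists (2%:R / 2 ^+ 0), 0%N, 2%N. Qed.

Lemma dyadic_height_ge0 x : 0 <= dyadic_height x.
Proof.
by apply: lb_le_inf; [exact: dyadic_values_neq0 | exact: dyadic_values_lbound].
Qed.

Lemma dyadic_height_le n k x : dyadic_set n k x -> dyadic_height x <= k%:R / 2 ^+ n.
Proof.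
move=> Dx; apply: ge_inf; last by exists n, k.
by exists 0; exact: dyadic_values_lbound.
Qed.

Lemma dyadic_height_ge n k x : ~ dyadic_set n k x -> k%:R / 2 ^+ n <= dyadic_height x.
Proof.
move=> nDx; apply: lb_le_inf; first exact: dyadic_values_neq0.
move=> _ [m [j [Dx ->]]]; rewrite leNgt; apply/negP.
rewrite ltr_pdivrMr ?exprn_gt0// mulrAC ltr_pdivlMr ?exprn_gt0//.
rewrite -!natrX -!natrM ltr_nat => lt_jk; apply: nDx.
rewrite -(dyadic_set_refine m n k); rewrite -(dyadic_set_refine n m j) addnC in Dx.
by apply: dyadic_set_mono Dx; rewrite mulnC (mulnC _ k); exact: ltnW.
Qed.

(** At level n let k be the least index of a set that contains x.  The complement
of the set of index k - 1 and the interior of the set of index k + 1 are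
neighbourhoods of x, on which the height is at least (k - 1) / 2^n and at most
(k + 1) / 2^n; for k = 0 the lower bound holds everywhere. *)
Lemma dyadic_height_continuous : continuous dyadic_height.
Proof.
move=> x; apply/cvgrPdist_lt => e e0.
have [n ne] : exists n, 2 / 2 ^+ n < e.
  have [n ne] := half_exp_lt (divr_gt0 e0 (ltr0Sn R 1)); exists n.
  by rewrite -exprVn mulrC -ltr_pdivlMr.
have ex : exists k, `[< dyadic_set n k x >].
  by exists (2 ^ n * 2)%N; apply/asboolP; rewrite dyadic_set_top.
case: (ex_minnP ex) => k /asboolP Dx kmin.
have Dy : \forall y \near x, dyadic_set n k.+1 y.
  by have [_] := dyadic_set_step n k; apply.
have ky : \forall y \near x, k%:R / 2 ^+ n - 2^-1 ^+ n <= dyadic_height y.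
  case: k {Dy} Dx kmin => [|k] Dx kmin.
    near=> y; rewrite mul0r sub0r; apply: le_trans (dyadic_height_ge0 y).
    by rewrite oppr_le0 exprn_ge0// invr_ge0.
  have nDx : ~ dyadic_set n k x.
    by move=> /asboolP /kmin; rewrite ltnn.
  have : \forall y \near x, ~ dyadic_set n k y.
    apply: open_nbhs_nbhs; split => //; apply: closed_openC.
    by have [PD _] := dyadic_set_step n k; exact: P_closed.
  apply: filterS => y /dyadic_height_ge.
  by rewrite exprVn -[k.+1%:R]natr1 mulrDl mul1r addrK.
have kx : k%:R / 2 ^+ n - 2^-1 ^+ n <= dyadic_height x := nbhs_singleton ky.
have hx := dyadic_height_le Dx.
near=> y.
have hy : k%:R / 2 ^+ n - 2^-1 ^+ n <= dyadic_height y by near: y.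
have : dyadic_height y <= k.+1%:R / 2 ^+ n.
  by apply: dyadic_height_le; near: y.
rewrite -[k.+1%:R]natr1 mulrDl mul1r -exprVn => hy'.
rewrite -exprVn in hx hy kx ne; rewrite ltr_norml.
have arith (a b u v d : R) : a <= v -> v - u <= b -> v - u <= a -> 2 * u < d ->
    b <= v + u -> - d < a - b < d by move=> *; apply/andP; split; lra.
exact: arith hx hy kx ne hy'.
Unshelve. all: by end_near. Qed.

Lemma dyadic_height0 x : F x -> dyadic_height x = 0.
Proof.
move=> Fx; apply/eqP; rewrite eq_le dyadic_height_ge0 andbT.
by have := @dyadic_height_le 0 0 x Fx; rewrite mul0r.
Qed.

Lemma dyadic_height_ge1 x : ~ W x -> 1 <= dyadic_height x.
Proof. by move=> Wx; have := @dyadic_height_ge 0 1 x Wx; rewrite divr1. Qed.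

Lemma dyadic_height_homo x y : (forall M, P M -> M x -> M y) ->
  dyadic_height y <= dyadic_height x.
Proof.
move=> xy; apply: lb_le_inf; first exact: dyadic_values_neq0.
move=> _ [n [k [Dx ->]]]; apply: dyadic_height_le.
by apply: xy Dx; case: (dyadic_set_step n k).
Qed.

End DyadicUrysohn.

(** * Dyadically weighted means *)

Section WeightedMean.
Context {R : realType}.
Implicit Types a b : nat -> R.

(** The weights 2^-(n+1) have total mass 1, so the mean of a sequence in [0, 1] is
in [0, 1], depends strictly monotonically on each term, and differs from its
N-th partial sum by at most 2^-N, uniformly in the sequence. *)
Definition dyadic_sum a N : R := \sum_(n < N) a n / 2 ^+ n.+1.

Definition dyadic_mean a : R := limn (dyadic_sum a).

Lemma dyadic_sumS a N : dyadic_sum a N.+1 = dyadic_sum a N + a N / 2 ^+ N.+1.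
Proof. by rewrite /dyadic_sum big_ord_recr. Qed.

Lemma half_expS N : 2^-1 ^+ N = 2^-1 ^+ N.+1 + 2^-1 ^+ N.+1 :> R.
Proof. by rewrite exprS; lra. Qed.

Lemma dyadic_sum1 N : dyadic_sum (fun=> 1) N = 1 - 2^-1 ^+ N.
Proof.
elim: N => [|N IH]; first by rewrite /dyadic_sum big_ord0 expr0 subrr.
rewrite dyadic_sumS IH half_expS mul1r -exprVn.
by rewrite opprD addrA subrK.
Qed.

Section Bounded.
Variable a : nat -> R.
Hypothesis a01 : forall n, 0 <= a n <= 1.

Let sum_nondec : nondecreasing_seq (dyadic_sum a).
Proof.
apply/nondecreasing_seqP => n; rewrite dyadic_sumS lerDl divr_ge0 ?exprn_ge0//.
by case/andP: (a01 n).
Qed.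

Let upper_noninc : nonincreasing_seq (fun N => dyadic_sum a N + 2^-1 ^+ N).
Proof.
apply/nonincreasing_seqP => n; rewrite dyadic_sumS -addrA lerD2l [leRHS]half_expS.
rewrite lerD2r -exprVn ler_piMl ?exprn_ge0 ?invr_ge0//.
by case/andP: (a01 n).
Qed.

Let sum_cvg : cvgn (dyadic_sum a).
Proof.
apply: nondecreasing_is_cvgn => //; exists 1 => _ [n _ <-].
have := upper_noninc (leq0n n); rewrite /dyadic_sum big_ord0 expr0 add0r.
by apply: le_trans; rewrite lerDl exprn_ge0 ?invr_ge0.
Qed.

Lemma dyadic_sum_le_mean N : dyadic_sum a N <= dyadic_mean a.
Proof. exact: nondecreasing_cvgn_le. Qed.

Lemma dyadic_mean_le_sum N : dyadic_mean a <= dyadic_sum a N + 2^-1 ^+ N.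
Proof.
have cu : dyadic_sum a n + 2^-1 ^+ n @[n --> \oo] --> dyadic_mean a.
  by rewrite -[dyadic_mean a]addr0; apply: cvgD => //; exact: half_exp_cvg0.
rewrite -(cvg_lim (@Rhausdorff R) cu).
by apply: nonincreasing_cvgn_ge => //; apply/cvg_ex; eexists; exact: cu.
Qed.

Lemma dyadic_mean_le c : (forall N, dyadic_sum a N <= c) -> dyadic_mean a <= c.
Proof. by move=> ac; apply: limr_le => //; apply: nearW. Qed.

End Bounded.

Lemma dyadic_mean_homo a b : (forall n, 0 <= a n <= 1) ->
  (forall n, 0 <= b n <= 1) -> (forall n, a n <= b n) ->
  dyadic_mean a <= dyadic_mean b.
Proof.
move=> a01 b01 ab; apply: dyadic_mean_le => // N.
apply: le_trans (dyadic_sum_le_mean b01 N); apply: ler_sum => n _.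
by rewrite ler_pM2r ?invr_gt0 ?exprn_gt0.
Qed.

Lemma dyadic_mean_lt a b i : (forall n, 0 <= a n <= 1) ->
  (forall n, 0 <= b n <= 1) -> (forall n, a n <= b n) -> a i < b i ->
  dyadic_mean a < dyadic_mean b.
Proof.
move=> a01 b01 ab abi; pose d := (b i - a i) / 2 ^+ i.+1.
have d0 : 0 < d by rewrite divr_gt0 ?subr_gt0 ?exprn_gt0.
suff : dyadic_mean a <= dyadic_mean b - d by move: d0; lra.
apply: dyadic_mean_le => // N; rewrite lerBrDr.
suff [M /le_trans] : exists M, dyadic_sum a N + d <= dyadic_sum b M.
  by apply; exact: dyadic_sum_le_mean.
exists (N + i.+1)%N.
have aN : dyadic_sum a N <= dyadic_sum a (N + i.+1).
  elim: i.+1 => [|k IH]; first by rewrite addn0.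
  rewrite addnS dyadic_sumS (le_trans IH)// lerDl divr_ge0 ?exprn_ge0//.
  by case/andP: (a01 (N + k)%N).
apply: (le_trans (lerD aN (lexx d))); rewrite addrC -lerBrDr.
rewrite /dyadic_sum -sumrB; have iN : (i < N + i.+1)%N by rewrite ltn_addl.
rewrite (bigD1 (Ordinal iN)) //= -mulrBl -/d lerDl sumr_ge0// => n _.
by rewrite -mulrBl divr_ge0 ?exprn_ge0// subr_ge0.
Qed.

Lemma dyadic_mean1 : dyadic_mean (fun=> 1) = 1.
Proof.
have one01 : forall n : nat, 0 <= (1 : R) <= 1 by move=> _; rewrite ler01 lexx.
apply/eqP; rewrite eq_le; apply/andP; split.
  by apply: dyadic_mean_le => // N; rewrite dyadic_sum1 gerBl exprn_ge0 ?invr_ge0.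
rewrite leNgt; apply/negP => lt1.
have [N Ne] := half_exp_lt (etrans (subr_gt0 _ _) lt1).
have := dyadic_sum_le_mean one01 N; rewrite dyadic_sum1.
by rewrite lerBlDr -lerBlDl leNgt Ne.
Qed.

Lemma dyadic_mean0 : dyadic_mean (fun=> 0) = 0.
Proof.
have zero01 : forall n : nat, 0 <= (0 : R) <= 1 by move=> _; rewrite ler01 lexx.
have sum0 N : dyadic_sum (fun=> 0) N = 0.
  by rewrite /dyadic_sum big1// => n _; rewrite mul0r.
apply/eqP; rewrite eq_le; apply/andP; split.
  by apply: dyadic_mean_le => // N; rewrite sum0.
by have := dyadic_sum_le_mean zero01 0; rewrite sum0.
Qed.

Lemma dyadic_mean_continuous (T : topologicalType) (f : nat -> T -> R) :
  (forall n, continuous (f n)) -> (forall n x, 0 <= f n x <= 1) ->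
  continuous (fun x => dyadic_mean (f ^~ x)).
Proof.
move=> cf f01 x; apply/cvgrPdist_lt => e e0.
have [N Ne] := half_exp_lt (divr_gt0 e0 (ltr0Sn R 1)).
have csum : continuous (fun x => dyadic_sum (f ^~ x) N).
  elim: N {Ne} => [|N IH] y.
    by rewrite /dyadic_sum; under eq_fun do rewrite big_ord0; exact: cvg_cst.
  under eq_fun do rewrite dyadic_sumS; apply: cvgD; first exact: IH.
  by apply: cvgM; [exact: cf | exact: cvg_cst].
have /cvgrPdist_lt /(_ (e / 2) (divr_gt0 e0 (ltr0Sn R 1))) := csum x.
apply: filterS => y.
have := dyadic_sum_le_mean (f01 ^~ x) N; have := dyadic_mean_le_sum (f01 ^~ x) N.
have := dyadic_sum_le_mean (f01 ^~ y) N; have := dyadic_mean_le_sum (f01 ^~ y) N.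
have arith (mx my sx sy u d : R) : u < d / 2 -> my <= sy + u -> sy <= my ->
    mx <= sx + u -> sx <= mx -> `|sx - sy| < d / 2 -> `|mx - my| < d.
  by rewrite !ltr_norml => *; apply/andP; split; lra.
exact: arith Ne.
Qed.

End WeightedMean.

(** * Continuous monotone functions for a closed preorder *)

(** A base indexed by the natural numbers is easier to diagonalize over than a
countable set of sets.  The index of a member of the base is its image under
an injection, and the indices outside the range yield empty sets. *)
Lemma compact_countable_base (R : realType) (X : metricType R) :
  compact [set: X] -> exists W : nat -> set X,
    forall x V, nbhs x V -> exists n, W n x /\ W n `<=` V.
Proof.
move=> cX; have [[x0]|noX] := pselect ([set: X] !=set0); last first.
  by exists (fun=> set0) => x; case: noX; exists x.
pose pX : isPointed X := isPointed.Build X x0.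
pose Xp : pseudoPMetricType R := HB.pack_for (pseudoPMetricType R) (X : Type) pX
  (X : pseudoMetricType R).
have [B cB [_ Bbase]] := @compact_second_countable R Xp cX.
have [f finj] := countable_injP _ cB.
exists (fun n => \bigcup_(U in [set U | B U /\ f U = n]) U) => x V xV.
have [U [BU Ux] UV] := Bbase x V xV.
exists (f U); split; first by exists U.
move=> y [U' [BU' fU] U'y]; apply: UV; suff <- : U' = U by [].
by apply: finj => //; exact/mem_set.
Qed.

Section ClosedPreorder.
Context {R : realType} {X : metricType R}.
Hypothesis cX : compact [set: X].
Variable K : set (X * X).
Hypothesis cK : closed K.
Hypothesis K_refl : forall x, K (x, x).
Hypothesis K_trans : forall x y z, K (x, y) -> K (y, z) -> K (x, z).
Implicit Types (A B F O U V : set X) (f g : X -> R).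

Definition increasing_set F := closed F /\ (forall x y, F x -> K (x, y) -> F y).

Lemma increasing_set_image A : closed A -> increasing_set (rel_image K A).
Proof.
move=> cA; split; first exact: closed_rel_image.
by move=> x y [z Az zx] xy; exists z => //; exact: K_trans zx xy.
Qed.

(** The analogue of normality for an ordered space (Nachbin): the upward closures
of the closed e-neighbourhoods of F decrease to the upward closure of F, which
is F itself, so one of them is contained in the open set. *)
Lemma increasing_nbhs F O : increasing_set F -> open O -> F `<=` O ->
  exists M, [/\ increasing_set M, F `<=` interior M & M `<=` O].
Proof.
move=> [cF incF] oO FO.
pose N (e : R) := closure [set y | exists2 x, F x & mdist x y < e].
have cN e : closed (N e) by exact: closed_closure.
have N_mono e e' : e <= e' -> N e `<=` N e'.
  move=> ee'; apply: closure_subset => y [x Fx xy]; exists x => //.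
  exact: lt_le_trans xy ee'.
have [e e0 NO] : exists2 e : R, 0 < e & rel_image K (N e) `<=` O.
  apply: contrapT => no.
  have [y yP] : exists y, forall e, [set e : R | 0 < e] e ->
      closure (rel_image K (N e) `&` ~` O) y.
    apply: compact_cluster_family => //; first by exists 1 => /=.
      move=> e e' /= e0 e'0; exists (Num.min e e'); first by rewrite /= lt_min e0.
      by move=> y [[x Nx xy] nOy]; split; split => //; exists x => //;
        apply: N_mono Nx; rewrite ge_min lexx ?orbT.
    move=> e e0; apply: contrapT => empty; apply: no; exists e => // y Ny.
    by apply: contrapT => nOy; apply: empty; exists y.
  have {}yP e : 0 < e -> rel_image K (N e) y /\ ~ O y.
    move=> /yP; apply: (_ : closed _); apply: closedI; last exact: open_closedC.
    exact: closed_rel_image.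
  have [z zP] : exists z, forall e, [set e : R | 0 < e] e ->
      closure (N e `&` [set x | K (x, y)]) z.
    apply: compact_cluster_family => //; first by exists 1 => /=.
      move=> e e' /= e0 e'0; exists (Num.min e e'); first by rewrite /= lt_min e0.
      by move=> x [Nx xy]; split; split => //; apply: N_mono Nx;
        rewrite ge_min lexx ?orbT.
    by move=> e /yP [[x Nx xy] _]; exists x.
  have {}zP e : 0 < e -> N e z /\ K (z, y).
    move=> /zP; apply: (_ : closed _); apply: closedI => //.
    exact: closed_rel_section.
  have Fz : F z.
    apply: cF; apply/metric_closureP => e e0.
    have e20 : 0 < e / 2 by rewrite divr_gt0.
    have [/metric_closureP Nz _] := zP _ e20.
    have [w [x Fx xw] zw] := Nz _ e20; exists x => //.
    rewrite (le_lt_trans (metric_triangle z w x))// [e]splitr ltrD//.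
    by rewrite metric_sym.
  have [_ zy] := zP 1 ltr01; have [_] := yP 1 ltr01; apply.
  by apply: FO; exact: incF zy.
exists (rel_image K (N e)); split => //; first exact: increasing_set_image.
move=> x Fx; apply/nbhs_ballP; exists e => //= y.
rewrite ballEmdist /= => xy; exists y => //; apply: subset_closure.
by exists x.
Qed.

Definition monotone_separator A B f := [/\ continuous f, forall x, 0 <= f x <= 1,
  forall x y, K (x, y) -> f x <= f y, forall x, A x -> f x = 1
  & forall x, B x -> f x = 0].

(** The construction of Urysohn with all sets taken upward closed: a point further
up in the preorder belongs to more of them, so the resulting height decreases
and its complement to 1 increases. *)
Lemma monotone_urysohn A B : increasing_set A -> closed B ->
  (forall x, A x -> B x -> False) -> exists f, monotone_separator A B f.
Proof.
move=> iA cB AB.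
have AB' : A `<=` ~` B by move=> x Ax Bx; exact: AB Ax Bx.
have [W [iW AW WB]] := increasing_nbhs iA (closed_openC cB) AB'.
have iT : increasing_set setT by split => //; exact: closedT.
have interp F V : increasing_set F -> increasing_set V -> F `<=` interior V ->
    exists M, [/\ increasing_set M, F `<=` interior M & M `<=` interior V].
  by move=> iF _ FV; exact: increasing_nbhs iF (open_interior _) FV.
pose h : X -> R := dyadic_height interp A W.
have ch : continuous h by apply: dyadic_height_continuous => // F [].
exists (fun x => 1 - Num.min 1 (h x)); split.
- move=> x; apply: cvgB; first exact: cvg_cst.
  by apply: continuous_min; [exact: cvg_cst | exact: ch].
- move=> x; have := dyadic_height_ge0 interp A W x; rewrite -/(h x) => hx0.
  rewrite subr_ge0 ge_min lexx /= gerBl le_min ler01 hx0 //.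
- move=> x y xy; rewrite lerD2l lerN2.
  have hyx : h y <= h x.
    by apply: dyadic_height_homo => // M [_ incM] Mx; exact: incM xy.
  by rewrite le_min !ge_min lexx hyx orbT.
- move=> x Ax; rewrite /h dyadic_height0 // min_r ?ler01// subr0 //.
- move=> x Bx; rewrite min_l ?subrr// /h dyadic_height_ge1// => Wx.
  exact: WB Wx Bx.
Qed.

Lemma increasing_setU A A' :
  increasing_set A -> increasing_set A' -> increasing_set (A `|` A').
Proof.
move=> [cA incA] [cA' incA']; split; first exact: closedU.
by move=> x y [Ax|A'x] xy; [left; exact: incA xy | right; exact: incA' xy].
Qed.

(** Given x outside A and y outside B with y not below x, the upward closed set
A `|` K(y) is disjoint from the downward closed set B `|` K^-1(x), and a
monotone separator of the two is strictly smaller near x than near y.  By a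
countable base, countably many such functions deal with all pairs. *)
Lemma exists_strict_separator A B : increasing_set A -> closed B ->
  (forall x y, B y -> K (x, y) -> B x) ->
  (forall x, A x -> B x -> False) ->
  exists f, [/\ monotone_separator A B f,
    forall x, f x = 1 -> A x, forall x, f x = 0 -> B x &
    forall x y, ~ A x -> ~ B y -> K (x, y) -> ~ K (y, x) -> f x < f y].
Proof.
move=> iA cB decB AB; have incA := iA.2.
have lt13_23 : 1 / 3 < 2 / 3 :> R by lra.
have lt23_1 : 2 / 3 < 1 :> R by lra.
(* The empty set is added to the base so that the condition on one of the two
   members of a pair can be made void; this is what makes the level sets of
   the values 0 and 1 exact. *)
have [W0 W0P] := compact_countable_base cX.
pose W n := if n is m.+1 then W0 m else set0.
have WP x V : nbhs x V -> exists n, W n x /\ W n `<=` V.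
  by move=> /W0P [n nP]; exists n.+1.
pose splits (ij : nat * nat) f :=
  (forall x, W ij.1 x -> f x < 1 / 3) /\ (forall y, W ij.2 y -> 2 / 3 < f y).
have [F FP] : {F : nat * nat -> X -> R & forall ij, monotone_separator A B (F ij) /\
    ((exists2 g, monotone_separator A B g & splits ij g) -> splits ij (F ij))}.
  apply: (choice (P := fun ij f => monotone_separator A B f /\
    ((exists2 g, monotone_separator A B g & splits ij g) -> splits ij f))) => ij.
  have [[g gAB gij]|no] := pselect (exists2 g, monotone_separator A B g & splits ij g).
    by exists g.
  by have [g gAB] := monotone_urysohn iA cB AB; exists g; split => // /no.
(* [F] indexed by the natural numbers; indices that encode no pair are sent
   to an arbitrary one. *)
pose G n := F (odflt (0, 0)%N (unpickle n)).
have GAB n : monotone_separator A B (G n) by case: (FP (odflt (0, 0)%N (unpickle n))).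
have G01 n x : 0 <= G n x <= 1 by case: (GAB n).
have Gmono n x y : K (x, y) -> G n x <= G n y by case: (GAB n) => _ _ + _ _; apply.
have Gsplits ij g : monotone_separator A B g -> splits ij g -> exists n, splits ij (G n).
  move=> gAB gij; exists (pickle ij); rewrite /G pickleK /=.
  by apply: (FP ij).2; exists g.
have near_lt g x (c : R) : monotone_separator A B g -> g x < c ->
    exists n, W n x /\ forall z, W n z -> g z < c.
  move=> [cg _ _ _ _] gxc.
  have gV : \forall z \near x, g z < c by exact: cvgr_lt (cg x) _ gxc.
  by have [n [Wx WV]] := WP x _ gV; exists n; split => // z /WV.
have near_gt g x (c : R) : monotone_separator A B g -> c < g x ->
    exists n, W n x /\ forall z, W n z -> c < g z.
  move=> [cg _ _ _ _] gxc.
  have gV : \forall z \near x, c < g z by exact: cvgr_gt (cg x) _ gxc.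
  by have [n [Wx WV]] := WP x _ gV; exists n; split => // z /WV.
have closed_below x : closed [set z | K (z, x)] by exact: closed_rel_section.
have inc_up y : increasing_set [set z | K (y, z)].
  have -> : [set z | K (y, z)] = rel_image K [set y].
    by apply/seteqP; split=> z; [exists y | move=> [_ -> ]].
  apply: increasing_set_image; apply: accessible_closed_set1.
  exact/hausdorff_accessible/metric_hausdorff.
have low x : ~ A x -> exists n, G n x < 1.
  move=> nAx.
  have [||g gAB] := @monotone_urysohn A (B `|` [set z | K (z, x)]) iA.
  - exact: closedU.
  - by move=> z Az [/(AB z Az)//|zx]; apply: nAx; exact: incA zx.
  have gx : g x = 0 by case: gAB => _ _ _ _; apply; right.
  have {}gAB : monotone_separator A B g.
    by case: gAB => ? ? ? ? g0; split => // z Bz; apply: g0; left.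
  have [|i [Wx gi]] := near_lt g x (1 / 3) gAB; first by rewrite gx divr_gt0.
  have [|n [Gn _]] := Gsplits (i, 0%N) g gAB; first by split.
  by exists n; have := Gn _ Wx; lra.
have high y : ~ B y -> exists n, 0 < G n y.
  move=> nBy.
  have [|||g gAB] := @monotone_urysohn (A `|` [set z | K (y, z)]) B.
  - exact: increasing_setU.
  - by [].
  - by move=> z [/AB//|yz] Bz; apply: nBy; exact: decB yz.
  have gy : g y = 1 by case: gAB => _ _ _ g1 _; apply: g1; right.
  have {}gAB : monotone_separator A B g.
    by case: gAB => ? ? ? g1 ?; split => // z Bz; apply: g1; left.
  have [|j [Wy gj]] := near_gt g y (2 / 3) gAB; first by rewrite gy.
  have [|n [_ Gn]] := Gsplits (0%N, j) g gAB; first by split.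
  by exists n; have := Gn _ Wy; lra.
exists (fun x => dyadic_mean (G ^~ x)).
have zero01 : forall n : nat, 0 <= (0 : R) <= 1 by move=> _; rewrite ler01 lexx.
have one01 : forall n : nat, 0 <= (1 : R) <= 1 by move=> _; rewrite ler01 lexx.
split.
- split.
  + by apply: dyadic_mean_continuous => // n; case: (GAB n).
  + move=> x; rewrite -{1}dyadic_mean0 -dyadic_mean1.
    by apply/andP; split; apply: dyadic_mean_homo => // n; case/andP: (G01 n x).
  + by move=> x y xy; apply: dyadic_mean_homo => // n; exact: Gmono.
  + move=> x Ax; rewrite -dyadic_mean1; congr dyadic_mean; apply/funext => n.
    by case: (GAB n) => _ _ _ g1 _; exact: g1.
  + move=> x Bx; rewrite -dyadic_mean0; congr dyadic_mean; apply/funext => n.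
    by case: (GAB n) => _ _ _ _; exact.
- move=> x fx; apply: contrapT => /low [n Gn].
  suff : dyadic_mean (G ^~ x) < dyadic_mean (fun=> 1) by rewrite fx dyadic_mean1 ltxx.
  by apply: (@dyadic_mean_lt _ _ _ n) => // k; case/andP: (G01 k x).
- move=> x fx; apply: contrapT => /high [n Gn].
  suff : dyadic_mean (fun=> 0) < dyadic_mean (G ^~ x) by rewrite fx dyadic_mean0 ltxx.
  by apply: (@dyadic_mean_lt _ _ _ n) => // k; case/andP: (G01 k x).
- move=> x y nAx nBy xy nyx.
  have [|||g gAB] := @monotone_urysohn (A `|` [set z | K (y, z)])
    (B `|` [set z | K (z, x)]).
  + exact: increasing_setU.
  + exact: closedU.
  + move=> z [Az|yz] [Bz|zx].
    * exact: AB Az Bz.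
    * by apply: nAx; exact: incA zx.
    * by apply: nBy; exact: decB yz.
    * by apply: nyx; exact: K_trans yz zx.
  have gx : g x = 0 by case: gAB => _ _ _ _; apply; right.
  have gy : g y = 1 by case: gAB => _ _ _ g1 _; apply: g1; right.
  have {}gAB : monotone_separator A B g.
    case: gAB => ? ? ? g1 g0; split => // z; first by move=> ?; apply: g1; left.
    by move=> ?; apply: g0; left.
  have [|i [Wx gi]] := near_lt g x (1 / 3) gAB; first by rewrite gx divr_gt0.
  have [|j [Wy gj]] := near_gt g y (2 / 3) gAB; first by rewrite gy.
  have [|n [Gx Gy]] := Gsplits (i, j) g gAB; first by split.
  apply: (@dyadic_mean_lt _ _ _ n) => // [k|]; first exact: Gmono.
  exact: lt_trans (Gx _ Wx) (lt_trans lt13_23 (Gy _ Wy)).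
Qed.

End ClosedPreorder.

(** * Composition, splitting and closedness of restricted semiflows *)

Section TripleProjections.
Context {T1 T2 T3 : topologicalType}.

Lemma continuous_fst_fst : continuous (fun w : T1 * T2 * T3 => w.1.1).
Proof. by move=> w; apply: (cvg_comp fst fst); exact: cvg_fst. Qed.

Lemma continuous_snd_fst : continuous (fun w : T1 * T2 * T3 => w.1.2).
Proof. by move=> w; apply: (cvg_comp fst snd); [exact: cvg_fst | exact: cvg_snd]. Qed.

End TripleProjections.

Section ClosedRelations.
Context {R : realType} {X : metricType R}.
Hypothesis cX : compact [set: X].

Lemma closed_diagonal : closed (@diagonal X).
Proof.
apply/metric_closed_relP => x y h /=; apply/eqP; apply: contrapT => /negP xy.
have xy0 : 0 < mdist x y by rewrite mdist_gt0.
have [z [z' [xz yz' /diagonalP zz']]] := h _ (divr_gt0 xy0 (ltr0Sn R 1)).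
have := metric_triangle x z y; rewrite leNgt => /negP; apply.
by rewrite [ltRHS]splitr ltrD// metric_sym zz'.
Qed.

Lemma closed_comp_rel (S T : set (X * X)) :
  closed S -> closed T -> closed (S \; T)%relation.
Proof.
move=> cS cT.
have -> : (S \; T)%relation = [set p | exists2 z, setT z &
    ([set q : X * X * X | T (q.1.1, q.2)] `&` [set q | S (q.2, q.1.2)]) (p, z)].
  apply/seteqP; split=> -[x y] [z]; first by move=> Txz Szy; exists z.
  by move=> _ [? ?]; exists z.
apply: closed_proj => //; apply: closedI.
  apply: (closed_comp (f := fun q : X * X * X => (q.1.1, q.2))) => // q _.
  by apply: cvg_pair; [exact: continuous_fst_fst | exact: cvg_snd].
apply: (closed_comp (f := fun q : X * X * X => (q.2, q.1.2))) => // q _.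
by apply: cvg_pair; [exact: cvg_snd | exact: continuous_snd_fst].
Qed.

(** In a compact space a cluster point of the image of an ultrafilter is its limit. *)
Lemma ultrafilter_cvg_comp (T : Type) (F : set_system T) (f : T -> X) :
  UltraFilter F -> exists l : X, f @ F --> l.
Proof.
move=> FU; have FF := @ultra_proper _ _ FU.
have [l [_ cl]] := cX (F := f @ F) (fmap_proper_filter f FF) filterT.
exists l => V Vl; have [//|FnV] := in_ultra_setVsetC (f @^-1` V) FU.
by have [z [nVz Vz]] := cl (~` V) V FnV Vl.
Qed.

End ClosedRelations.

Section FlowRestriction.
Context {R : realType} {X : metricType R}.
Variable Phi : set (X * R * X).
Hypothesis Phi_semiflow : semiflow_relation Phi.
Variable C : set X.

Local Notation flowC := (flow_restriction Phi C).

Lemma semiflow0 x y : Phi (x, 0, y) <-> x = y.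
Proof.
have [_ _ Phi0 _] := Phi_semiflow.
by rewrite -[Phi (x, 0, y)]/(time_slice Phi 0 (x, y)) Phi0 diagonalP.
Qed.

Lemma semiflowD x y z s t : Phi (x, s, y) -> Phi (y, t, z) -> Phi (x, s + t, z).
Proof.
have [_ Phi_ge0 _ PhiD] := Phi_semiflow => xy yz.
rewrite -[Phi _]/(time_slice Phi (s + t) (x, z)) addrC -PhiD.
- by exists y.
- exact: Phi_ge0 yz.
- exact: Phi_ge0 xy.
Qed.

Lemma flow_restriction_refl0 x y : flowC (x, 0, y) -> x = y.
Proof. by move=> [_ _ _ [p [_ <- <- _]]]. Qed.

(** The concatenated path satisfies the semiflow condition across the junction by
the composition law of Phi. *)
Lemma flow_restrictionD x y z s t :
  flowC (x, s, y) -> flowC (y, t, z) -> flowC (x, s + t, z).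
Proof.
move=> [Cx s0 Cy [p [Cp p0 ps pPhi]]] [_ t0 Cz [q [Cq q0 qt qPhi]]].
split => //; first exact: addr_ge0.
exists (fun u => if u <= s then p u else q (u - s)); split.
- move=> u /andP[u0 ut]; case: ifPn => [us|]; first by apply: Cp; rewrite u0.
  by rewrite -ltNge => su; apply: Cq; rewrite subr_ge0 ltW// lerBlDl.
- by rewrite s0.
- case: ifPn => [st|_]; last by rewrite addrAC subrr add0r.
  have t00 : t = 0 by move: st t0; lra.
  by move: qt; rewrite t00 addr0 ps q0.
move=> u v u0 uv vst; case: ifPn => us; case: ifPn => vs.
- exact: pPhi.
- rewrite -ltNge in vs.
  have yv : Phi (y, v - s, q (v - s)).
    by have := qPhi 0 (v - s); rewrite q0 subr0; apply; rewrite ?subr_gt0// lerBlDl.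
  have uy : Phi (p u, s - u, y).
    move: us; rewrite le_eqVlt => /predU1P[->|us]; last by rewrite -ps; exact: pPhi.
    by rewrite subrr ps; apply/semiflow0.
  by have := semiflowD uy yv; rewrite addrC addrA subrK.
- by move: us; rewrite (le_trans (ltW uv) vs).
- rewrite -!ltNge in us vs.
  have := qPhi (u - s) (v - s); rewrite opprB addrA subrK; apply.
  + by rewrite subr_ge0 ltW.
  + by rewrite ltrD2r.
  + by rewrite lerBlDl.
Qed.

Lemma flow_restriction_split x z (s t : R) : 0 <= s -> 0 <= t ->
  flowC (x, s + t, z) -> exists2 y, flowC (x, s, y) & flowC (y, t, z).
Proof.
move=> s0 t0 [Cx _ Cz [p [Cp p0 pst pPhi]]].
have Cps : C (p s) by apply: Cp; rewrite s0 lerDl.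
exists (p s); split => //.
  exists p; split => // [u /andP[u0 us]|u v u0 uv vs].
    by apply: Cp; rewrite u0 (le_trans us)// lerDl.
  by apply: pPhi => //; rewrite (le_trans vs)// lerDl.
exists (fun u => p (s + u)); split => //.
- by move=> u /andP[u0 ut]; apply: Cp; rewrite addr_ge0//= lerD2l.
- by rewrite addr0.
- move=> u v u0 uv vt.
  have := pPhi (s + u) (s + v); rewrite opprD addrACA subrr add0r; apply.
  + by rewrite addr_ge0.
  + by rewrite ltrD2l.
  + by rewrite lerD2l.
Qed.

Hypothesis cX : compact [set: X].
Hypothesis cC : closed C.

(** Rescaling to [0, 1] gives all paths the same domain, whatever their length t,
so that limits can be taken pointwise.  For t = 0 such a path is constant. *)
Let unit_path (w : X * R * X) (q : R -> X) :=
  [/\ (forall s, 0 <= s <= 1 -> C (q s)), q 0 = w.1.1, q 1 = w.2 &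
   forall s1 s2, 0 <= s1 -> s1 <= s2 -> s2 <= 1 ->
     Phi (q s1, (s2 - s1) * w.1.2, q s2)].

Let flow_restrictionP w : flowC w <-> 0 <= w.1.2 /\ exists q, unit_path w q.
Proof.
case: w => [[x t] y]; split.
  move=> [Cx t0 Cy [p [Cp p0 pt pPhi]]]; split => //.
  exists (fun s => p (s * t)); split; rewrite ?mul0r ?mul1r //=.
    by move=> s /andP[s0 s1]; apply: Cp; rewrite mulr_ge0// ler_piMl.
  move=> s1 s2 s10 s12 s21.
  have : s1 * t <= s2 * t by rewrite ler_wpM2r.
  rewrite mulrBl le_eqVlt => /predU1P[->|lt12].
    by rewrite subrr; apply/semiflow0.
  by apply: pPhi => //; rewrite ?mulr_ge0// ler_piMl.
move=> /= [t0 [q [Cq q0 q1 qPhi]]].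
have q01 : t = 0 -> q 0 = q 1.
  move=> t00; have := qPhi 0 1 (lexx 0) ler01 (lexx 1).
  by rewrite /= t00 mulr0 => /semiflow0.
have Cx : C x by rewrite -[x]q0; apply: Cq; rewrite lexx ler01.
have Cy : C y by rewrite -[y]q1; apply: Cq; rewrite lexx ler01.
split => //.
(* For t = 0 the quotient is 0 and the path is constant. *)
exists (fun s => q (s / t)); split.
- move=> s /andP[s0 st]; apply: Cq; rewrite divr_ge0//=.
  move: t0; rewrite le_eqVlt => /predU1P[<-|t0]; first by rewrite invr0 mulr0 ler01.
  by rewrite ler_pdivrMr// mul1r.
- by rewrite mul0r.
- have [t00|tn0] := eqVneq t 0; last by rewrite divff.
  by rewrite -[y]q1 -q01// t00 mul0r.
- move=> s1 s2 s10 s12 s2t; have t1 : 0 < t by lra.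
  have := qPhi (s1 / t) (s2 / t); rewrite /= -mulrBl divfK ?gt_eqF//; apply.
  + by rewrite divr_ge0.
  + by rewrite ler_pM2r ?invr_gt0// ltW.
  + by rewrite ler_pdivrMr// mul1r.
Qed.

(** Along an ultrafilter the rescaled paths converge at each time; the conditions
on a path are closed and each of them involves at most two times, so they pass
to the pointwise limit. *)
Lemma closed_flow_restriction : closed flowC.
Proof.
have [cPhi _ _ _] := Phi_semiflow.
move=> w; rewrite closureEcvg => -[G PG [Gw GC]].
have [F [FU GF]] := ultraFilterLemma PG.
have FF : ProperFilter F := @ultra_proper _ _ FU.
have Fw : F --> w by exact: cvg_trans GF Gw.
have FC : F flowC by apply: GF; exact: GC.
have [Q QP] : {Q : X * R * X -> R -> X & forall v, flowC v -> unit_path v (Q v)}.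
  apply: (choice (P := fun v q => flowC v -> unit_path v q)) => v.
  have [/flow_restrictionP[_ [q qv]]|nv] := pselect (flowC v); first by exists q.
  by exists (fun=> w.2).
have [q qP] : {q : R -> X & forall s, Q v s @[v --> F] --> q s}.
  apply: (choice (P := fun s l => Q v s @[v --> F] --> l)) => s.
  exact: ultrafilter_cvg_comp.
have F1 : v.1.1 @[v --> F] --> w.1.1 by move=> V /continuous_fst_fst /Fw.
have F2 : v.1.2 @[v --> F] --> w.1.2 by move=> V /continuous_snd_fst /Fw.
have F3 : v.2 @[v --> F] --> w.2 by move=> V /(@cvg_snd _ _ (nbhs w.1)) /Fw.
have unique (f g : X * R * X -> X) (a b : X) :
    (forall v, flowC v -> f v = g v) -> f @ F --> a -> g @ F --> b -> a = b.
  move=> fg fa gb; apply: (cvg_unique (@metric_hausdorff _ X) fa).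
  by apply: cvg_trans gb; apply: near_eq_cvg; apply: filterS FC => v /fg.
have near_path s : 0 <= s <= 1 -> F [set v | C (Q v s)].
  by move=> s01; apply: filterS FC => v /QP [+ _ _ _]; apply.
apply/flow_restrictionP; split.
  apply: (@closed_cvg _ _ _ _ _ (fun t : R => 0 <= t) (@closed_ge _ 0) _ _ F2).
  by apply: filterS FC => v /flow_restrictionP [].
exists q; split.
- move=> s s01.
  exact: (@closed_cvg _ _ _ _ _ C cC (near_path s s01) _ (qP s)).
- by apply: (unique (Q ^~ 0) (fun v => v.1.1) _ _ _ (qP 0) F1) => v /QP [].
- by apply: (unique (Q ^~ 1) snd _ _ _ (qP 1) F3) => v /QP [].
- move=> s1 s2 s10 s12 s21.
  pose g (v : X * R * X) : R := (s2 - s1) * v.1.2.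
  have cg : g v @[v --> F] --> (g w : R) by apply: cvgM F2; exact: cvg_cst.
  apply: cPhi => V [[V12 V3] /= [[[V1 V2] /= [V1n V2n] sub12] V3n] sub].
  have F1V : F [set v | V1 (Q v s1)] by exact: qP s1 _ V1n.
  have F2V : F [set v | V2 (g v)] by exact: cg _ V2n.
  have F3V : F [set v | V3 (Q v s2)] by exact: qP s2 _ V3n.
  have [v [[[V1v V2v] V3v] Cv]] := filter_ex
    (filterI (filterI (filterI F1V F2V) F3V) FC).
  exists (Q v s1, g v, Q v s2); split; first by have /QP [_ _ _] := Cv; apply.
  by apply: sub; split => //; exact: sub12.
Qed.

End FlowRestriction.

(** * The preorder of a hybrid system *)

Section HybridRelation.
Context {R : realType} {X : metricType R}.
Hypothesis cX : compact [set: X].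
Variable H : hybrid_system X.

Local Notation CH := (chain_rel (hybrid_rel H)).
Local Notation flowC := (hybrid_flowC H).

Let flowCD x y z (s t : R) :
  flowC (x, s, y) -> flowC (y, t, z) -> flowC (x, s + t, z).
Proof. by move=> xy yz; exact: (flow_restrictionD (hybrid_flowP H) xy yz). Qed.

(** Projection along the compact interval of times. *)
Lemma closed_flowC_times (a b : R) :
  closed (\bigcup_(t in `[a, b]) phiC H t : set (X * X)).
Proof.
have -> : \bigcup_(t in `[a, b]) phiC H t = [set p | exists2 t, `[a, b]%classic t &
    [set q : X * X * R | flowC (q.1.1, q.2, q.1.2)] (p, t)] by [].
apply: closed_proj; first exact: segment_compact.
have cF := closed_flow_restriction (hybrid_flowP H) cX (@hybrid_dom_closed _ _ H).
have cont : continuous (fun q : X * X * R => (q.1.1, q.2, q.1.2)).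
  move=> q V [[V12 V3] /= [[[V1 V2] /= [V1n V2n] sub12] V3n] sub].
  have N1 : \forall r \near q, V1 r.1.1 by exact: continuous_fst_fst.
  have N2 : \forall r \near q, V2 r.2 by exact: cvg_snd.
  have N3 : \forall r \near q, V3 r.1.2 by exact: continuous_snd_fst.
  apply: filterS (filterI (filterI N1 N2) N3) => r [[V1r V2r] V3r].
  by apply: sub; split => //; exact: sub12.
by apply: closed_comp cF => // q _; exact: cont.
Qed.

Lemma closed_phiC_I : closed (phiC_I H).
Proof. by apply: closedU; [exact: closed_diagonal | exact: closed_flowC_times]. Qed.

Lemma closed_hybrid_rel : closed (hybrid_rel H).
Proof.
apply: closedU; last exact: closed_flowC_times.
apply: closed_comp_rel => //; first exact: closed_phiC_I.
by apply: closed_comp_rel => //; [exact: hybrid_jump_closed | exact: closed_phiC_I].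
Qed.

Lemma phiC_I_flow x (t : R) y : t <= 1 -> flowC (x, t, y) -> phiC_I H (x, y).
Proof.
move=> t1 xy; right; exists t => //=; rewrite in_itv /= t1 andbT.
by case: xy.
Qed.

Lemma phiC_I_inv x y : phiC_I H (x, y) -> x = y \/
  exists t : R, 0 < t <= 1 /\ flowC (x, t, y).
Proof.
move=> [/diagonalP|[t /=]]; first by left.
rewrite in_itv /= le_eqVlt => /andP[/predU1P[<-|t0] t1] xy.
  by left; exact: flow_restriction_refl0 xy.
by right; exists t; rewrite t0.
Qed.

Lemma jump_hybrid_rel : hybrid_jump H `<=` hybrid_rel H.
Proof. by move=> [x y] xy; left; exists y; [exists x; [left|] | left]. Qed.

(** A flow line of length at least 1 can be cut into pieces of length in [1, 2]. *)
Lemma chain_rel_flow x (t : R) y : 1 <= t -> flowC (x, t, y) -> CH (x, y).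
Proof.
move=> t1 xy.
have [n tn] : exists n, t <= n.+2%:R.
  exists (Num.bound t); apply: (le_trans (ltW (archi_boundP _))); first lra.
  by rewrite ler_nat -addn2 leq_addr.
elim: n t x t1 xy tn => [|n IH] t x t1 xy tn.
  by apply: sub_chain_rel; right; exists t => //=; rewrite in_itv /= t1.
have [t2|t2] := leP t 2.
  by apply: sub_chain_rel; right; exists t => //=; rewrite in_itv /= t1.
rewrite -(subrK 1 t) addrC in xy.
have [|z xz zy] := flow_restriction_split ler01 _ xy; first lra.
apply: (@chain_rel_trans _ _ _ _ z).
  by apply: sub_chain_rel; right; exists 1 => //=; rewrite in_itv /= lexx ler1n.
by apply: (IH (t - 1)) => //; [lra | rewrite lerBlDr natr1].
Qed.

(** The loop is followed often enough for its total length to reach 1. *)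
Lemma flowC_loop_chain x (t : R) : 0 < t -> flowC (x, t, x) -> CH (x, x).
Proof.
move=> t0 xx.
have loop n : flowC (x, n.+1%:R * t, x).
  elim: n => [|n IH]; first by rewrite mul1r.
  by rewrite -natr1 mulrDl mul1r; exact: flowCD IH xx.
have tb : t^-1 < (Num.bound t^-1)%:R by rewrite archi_boundP ?invr_ge0 ?ltW.
apply: chain_rel_flow (loop (Num.bound t^-1)).
rewrite -ler_pdivrMr// div1r.
by rewrite (le_trans (ltW tb))// ler_nat.
Qed.

Lemma phiC_I_trans x y z : phiC_I H (x, y) -> phiC_I H (y, z) ->
  phiC_I H (x, z) \/ CH (x, z).
Proof.
move=> xy yz; have [->|[s [/andP[s0 s1] xys]]] := phiC_I_inv xy; first by left.
have [<-|[t [/andP[t0 t1] yzt]]] := phiC_I_inv yz; first by left.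
have xz := flowCD xys yzt.
have [st|st] := leP (s + t) 1; first by left; exact: phiC_I_flow xz.
by right; apply: chain_rel_flow xz; exact: ltW.
Qed.

Lemma phiC_I_loop x y : phiC_I H (x, y) -> phiC_I H (y, x) -> x <> y -> CH (x, x).
Proof.
move=> xy yx nxy; have [//|[s [/andP[s0 s1] xys]]] := phiC_I_inv xy.
have [/esym //|[t [/andP[t0 t1] yxt]]] := phiC_I_inv yx.
exact: flowC_loop_chain (addr_gt0 s0 t0) (flowCD xys yxt).
Qed.

(** The flow after the jump and the added flow together last at most 1, which makes
a single step of H, or more than 1, which is a chain to be followed after a step
of H that ends at the jump.  If the step of H is a flow step, the total time is
at least 1 and [chain_rel_flow] applies. *)
Lemma hybrid_rel_phiC_I x y z : hybrid_rel H (x, y) -> phiC_I H (y, z) -> CH (x, z).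
Proof.
move=> [[w [v xv vw] wy] yz|[t /= tJ xy] yz].
  have [wz|wz] := phiC_I_trans wy yz.
    by apply: sub_chain_rel; left; exists w => //; exists v.
  apply: chain_rel_trans wz; apply: sub_chain_rel; left.
  by exists w; [exists v | left].
have [<-|[s [/andP[s0 s1] yzs]]] := phiC_I_inv yz.
  by apply: sub_chain_rel; right; exists t.
apply: chain_rel_flow (flowCD xy yzs).
by move: tJ; rewrite in_itv /= => /andP[t1 _]; lra.
Qed.

Lemma phiC_I_hybrid_rel x y z : phiC_I H (x, y) -> hybrid_rel H (y, z) -> CH (x, z).
Proof.
move=> xy [[w [v yv vw] wz]|[t /= tJ yz]].
  have [xv|xv] := phiC_I_trans xy yv.
    by apply: sub_chain_rel; left; exists w => //; exists v.
  apply: chain_rel_trans xv _; apply: sub_chain_rel; left.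
  by exists w => //; exists v => //; left.
have [->|[s [/andP[s0 s1] xys]]] := phiC_I_inv xy.
  by apply: sub_chain_rel; right; exists t.
apply: chain_rel_flow (flowCD xys yz).
by move: tJ; rewrite in_itv /= => /andP[t1 _]; lra.
Qed.

Lemma chain_rel_phiC_I x y z : CH (x, y) -> phiC_I H (y, z) -> CH (x, z).
Proof.
move=> /(chain_rel_last cX closed_hybrid_rel) [w xw wy] yz.
have wz := hybrid_rel_phiC_I wy yz.
by case: xw => [->|xw] //; exact: chain_rel_trans xw wz.
Qed.

Lemma phiC_I_chain_rel x y z : phiC_I H (x, y) -> CH (y, z) -> CH (x, z).
Proof.
move=> xy /(chain_rel_first cX closed_hybrid_rel) [w yw wz].
have xw := phiC_I_hybrid_rel xy yw.
by case: wz => [<-|wz] //; exact: chain_rel_trans xw wz.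
Qed.

(** The flow over short times is added to the chain relation because a short flow
line need not be prolongable to a step of H. *)
Definition hybrid_preorder := phiC_I H `|` CH.

Lemma closed_hybrid_preorder : closed hybrid_preorder.
Proof.
by apply: closedU; [exact: closed_phiC_I | exact: closed_chain_rel closed_hybrid_rel].
Qed.

Lemma hybrid_preorder_refl x : hybrid_preorder (x, x).
Proof. by left; left. Qed.

Lemma hybrid_preorder_trans x y z :
  hybrid_preorder (x, y) -> hybrid_preorder (y, z) -> hybrid_preorder (x, z).
Proof.
move=> [xy|xy] [yz|yz].
- exact: phiC_I_trans xy yz.
- by right; exact: phiC_I_chain_rel xy yz.
- by right; exact: chain_rel_phiC_I xy yz.
- by right; exact: chain_rel_trans xy yz.
Qed.

Lemma hybrid_preorder_antisym x y :
  hybrid_preorder (x, y) -> hybrid_preorder (y, x) -> x <> y -> CH (x, x).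
Proof.
move=> [xy|xy] [yx|yx] nxy.
- exact: phiC_I_loop xy yx nxy.
- exact: phiC_I_chain_rel xy yx.
- exact: chain_rel_phiC_I xy yx.
- exact: chain_rel_trans xy yx.
Qed.

Lemma flowC_hybrid_preorder x (t : R) y : flowC (x, t, y) -> hybrid_preorder (x, y).
Proof.
move=> xy; have [t1|t1] := leP t 1; first by left; exact: phiC_I_flow xy.
by right; apply: chain_rel_flow xy; exact: ltW.
Qed.

Variables A B : set X.
Hypothesis hAB : hybrid_attractor_repeller_pair H A B.

(** For the short flow, the point x is reached by a step of H from another point of
A, and flowing on from x is then a chain from that point. *)
Lemma hybrid_preorder_attractor x y : A x -> hybrid_preorder (x, y) -> A y.
Proof.
move=> Ax [xy|]; last exact: (chain_rel_attractor cX closed_hybrid_rel hAB).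
have [w Aw wx] := attractor_pred cX closed_hybrid_rel hAB Ax.
apply: (chain_rel_attractor cX closed_hybrid_rel hAB Aw).
exact: hybrid_rel_phiC_I wx xy.
Qed.

Lemma hybrid_preorder_repeller x y : B y -> hybrid_preorder (x, y) -> B x.
Proof.
move=> By [xy|]; last exact: (chain_rel_repeller cX closed_hybrid_rel hAB).
have [w Bw yw] := repeller_succ cX closed_hybrid_rel hAB By.
apply: (chain_rel_repeller cX closed_hybrid_rel hAB Bw).
exact: phiC_I_hybrid_rel xy yw.
Qed.

End HybridRelation.

(** * The Lyapunov function *)

Section CompactExtrema.
Context {R : realType} {T : topologicalType}.
Variables (f : T -> R) (D : set T).
Hypotheses (cf : continuous f) (cD : compact D).

Lemma compact_max : D !=set0 -> exists2 c, D c & forall x, D x -> f x <= f c.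
Proof.
move=> D0; have [c /set_mem Dc cmax] := compact_EVT_max D0 cD (continuous_subspaceT cf).
by exists c => // x Dx; apply: cmax; exact/mem_set.
Qed.

Lemma compact_min : D !=set0 -> exists2 c, D c & forall x, D x -> f c <= f x.
Proof.
move=> D0; have [c /set_mem Dc cmin] := compact_EVT_min D0 cD (continuous_subspaceT cf).
by exists c => // x Dx; apply: cmin; exact/mem_set.
Qed.

Lemma compact_ereal_sup_lt (b : R) : (forall x, D x -> f x < b) ->
  (ereal_sup [set (f x)%:E | x in D] < b%:E)%E.
Proof.
move=> fb; have [D0|/nonemptyPn ->] := pselect (D !=set0); last first.
  by rewrite image_set0 ereal_sup0 ltNyr.
have [c Dc cmax] := compact_max D0.
apply: (@le_lt_trans _ _ (f c)%:E); last by rewrite lte_fin fb.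
by apply: ge_ereal_sup => _ [x Dx <-]; rewrite lee_fin cmax.
Qed.

Lemma compact_ereal_inf_gt (b : R) : (forall x, D x -> b < f x) ->
  (b%:E < ereal_inf [set (f x)%:E | x in D])%E.
Proof.
move=> fb; have [D0|/nonemptyPn ->] := pselect (D !=set0); last first.
  by rewrite image_set0 ereal_inf0 ltry.
have [c Dc cmin] := compact_min D0.
apply: (@lt_le_trans _ _ (f c)%:E); first by rewrite lte_fin fb.
by apply: le_ereal_inf_tmp => _ [x Dx <-]; rewrite lee_fin cmin.
Qed.

End CompactExtrema.

Section LyapunovProperties.
Context {R : realType} {X : metricType R}.
Hypothesis cX : compact [set: X].
Variables (H : hybrid_system X) (A B : set X).
Hypothesis hAB : hybrid_attractor_repeller_pair H A B.
Variable L : X -> R.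

Local Notation CH := (chain_rel (hybrid_rel H)).

Hypothesis L_continuous : continuous L.
Hypothesis L01 : forall x, 0 <= L x <= 1.
Hypothesis L_eq1 : forall x, A x <-> L x = 1.
Hypothesis L_eq0 : forall x, B x <-> L x = 0.
Hypothesis L_homo : forall x y, hybrid_preorder H (x, y) -> L x <= L y.
Hypothesis L_stationary : forall x y, hybrid_preorder H (x, y) -> x <> y ->
  L y = L x -> (A x /\ A y) \/ (B x /\ B y).

Let cH := @closed_hybrid_rel R X cX H.

Let recurrent x : CH (x, x) -> A x \/ B x.
Proof. exact: (chain_recurrent_attractor_repeller cX cH hAB). Qed.

Let chain_strict x y : CH (x, y) -> L y = L x -> (A x /\ A y) \/ (B x /\ B y).
Proof.
move=> xy Lyx; have [e|nxy] := pselect (x = y); last first.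
  by apply: L_stationary => //; right.
by move: xy; rewrite -e => /recurrent [?|?]; [left | right].
Qed.

(** Off A and B the function increases strictly along CH; as CH has compact sections,
the extrema are attained and the strict inequalities survive.  On A and B exact
predecessors and successors with the same value make the point critical. *)
Lemma critical_points_attractor_repeller : critical_points CH L = A `|` B.
Proof.
apply/seteqP; split=> x.
  rewrite /critical_points /=; apply: contra_notP => nAB.
  have strict y z : CH (y, z) -> (x = y \/ x = z) -> L y < L z.
    move=> yz xyz; rewrite lt_neqAle L_homo ?andbT; last by right.
    apply/eqP => /esym /(chain_strict yz) yzAB; apply: nAB.
    by case: xyz yzAB => -> [[? ?]|[? ?]]; [left | right | left | right].
  have cCH := closed_chain_rel cX cH.
  split.
    apply: (compact_ereal_sup_lt (D := [set y | CH (y, x)])) => //.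
      by apply: subclosed_compact cX _ => //; exact: closed_rel_section.
    by move=> y yx; apply: strict => //; right.
  apply: (compact_ereal_inf_gt (D := [set y | CH (x, y)])) => //.
    apply: subclosed_compact cX _ => //.
    exact: closed_rel_section (closed_rel_inv cCH).
  by move=> y xy; apply: strict => //; left.
move=> [Ax|Bx] [supL infL].
  have [w Aw wx] := attractor_pred cX cH hAB Ax.
  have : ((L w)%:E <= ereal_sup [set (L y)%:E | y in [set y | CH (y, x)]])%E.
    by apply: ereal_sup_ubound; exists w => //; exact: sub_chain_rel.
  by move=> /le_lt_trans /(_ supL); rewrite lte_fin (L_eq1 _).1// (L_eq1 _).1// ltxx.
have [w Bw xw] := repeller_succ cX cH hAB Bx.
have : (ereal_inf [set (L y)%:E | y in [set y | CH (x, y)]] <= (L w)%:E)%E.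
  by apply: ereal_inf_lbound; exists w => //; exact: sub_chain_rel.
by move=> /(lt_le_trans infL); rewrite lte_fin (L_eq0 _).1// (L_eq0 _).1// ltxx.
Qed.

Section Superlevel.
Variable a : R.
Hypothesis a01 : 0 < a < 1.

Local Notation Ua := [set x | a <= L x].

Let superlevel_attractor x : A x \/ B x -> a <= L x -> L x = 1.
Proof.
move=> [/L_eq1 //|/L_eq0 ->]; case/andP: a01 => a0 _.
by rewrite leNgt a0.
Qed.

(** Points at the very level a are pushed strictly above it: L is stationary only
along steps inside A or B, where it takes the values 1 and 0. *)
Let push x y : hybrid_preorder H (x, y) -> (x = y -> CH (x, x)) ->
  a <= L x -> a < L y.
Proof.
move=> xy loop ax; have := L_homo xy; rewrite le_eqVlt => /predU1P[Lxy|]; last first.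
  exact: le_lt_trans.
have ABx : A x \/ B x.
  have [/loop /recurrent //|nxy] := pselect (x = y).
  by have [[? _]|[? _]] := L_stationary xy nxy (esym Lxy); [left | right].
by rewrite -Lxy (superlevel_attractor ABx ax); case/andP: a01.
Qed.

Let chain_push x y : CH (x, y) -> a <= L x -> a < L y.
Proof. by move=> xy; apply: push; [right | move=> e; rewrite {2}e]. Qed.

Let gt_interior y : a < L y -> interior Ua y.
Proof.
move=> ay; have : \forall z \near y, a < L z 
    by exact: cvgr_gt (@L_continuous y) _ ay.
by apply: filterS => z /ltW.
Qed.

Lemma superlevel_closed : closed Ua.
Proof.
apply: (@closed_comp _ _ L [set r | a <= r]); last exact: closed_ge.
by move=> x _; exact: L_continuous.
Qed.

Lemma superlevel_inward : inward H Ua.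
Proof.
split; first exact: superlevel_closed.
  move=> y [x ax /jump_hybrid_rel /sub_chain_rel xy].
  by apply: gt_interior; exact: chain_push xy ax.
move=> t t0 y [x ax xy]; apply: gt_interior.
apply: push ax; first exact: flowC_hybrid_preorder xy.
by move=> e; move: xy; rewrite -e; exact: flowC_loop_chain.
Qed.

(** L is minimized over the attractor D of the superlevel set at some m.  A
predecessor w of m in D satisfies L m <= L w <= L m, and a step of H along which
L is stationary lies in A or in B; hence m lies in A and the minimum is 1. *)
Lemma superlevel_associated_attractor : associated_attractor H Ua = A.
Proof.
have a1 : a <= 1 by case/andP: a01 => _ /ltW.
have HU : rel_image (hybrid_rel H) Ua `<=` Ua.
  by move=> y [x ax xy]; apply/ltW/(chain_push _ ax); exact: sub_chain_rel.
apply/seteqP; split; last first.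
  apply: sub_iter_limit => [x /L_eq1 /= -> //|x Ax].
  by have [w Aw wx] := attractor_pred cX cH hAB Ax; exists w.
move=> x Dx; have DU : iter_limit (hybrid_rel H) Ua `<=` Ua.
  by move=> y /iter_limit_sub /HU.
have cD : compact (iter_limit (hybrid_rel H) Ua).
  by apply: subclosed_compact cX _ => //; apply: closed_iter_limit superlevel_closed.
have [m Dm mmin] := compact_min L_continuous cD (ex_intro _ x Dx).
have [w Dw wm] := iter_limit_pred cX cH superlevel_closed HU Dm.
have wm' : CH (w, m) by exact: sub_chain_rel.
have Lwm : L m = L w by apply/eqP; rewrite eq_le mmin// L_homo//; right.
have ABm : A m \/ B m.
  by have [[_ ?]|[_ ?]] := chain_strict wm' Lwm; [left | right].
apply/L_eq1/eqP; rewrite eq_le; case/andP: (L01 x) => _ -> /=.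
by rewrite -(superlevel_attractor ABm (DU _ Dm)) mmin.
Qed.

End Superlevel.

(** The maximum of L off an open set that contains A is less than 1, so any level
between this maximum and 1 will do. *)
Lemma superlevel_sub_nbhs V : set_nbhs A V ->
  exists a : R, 0 < a < 1 /\ [set x | a <= L x] `<=` V.
Proof.
move=> /set_nbhsP [W [oW AW WV]].
have [nW0|/nonemptyPn nW0] := pselect ((~` W) !=set0); last first.
  exists (1 / 2); split; first by apply/andP; split; lra.
  by move=> x _; apply: WV; apply: contrapT => nWx; rewrite -[False]/(set0 x) -nW0.
have cW : compact (~` W) by apply: subclosed_compact cX _ => //; exact: open_closedC.
have [c nWc cmax] := compact_max L_continuous cW nW0.
have Lc1 : L c < 1.
  have /andP[_ Lc1] := L01 c; rewrite lt_neqAle Lc1 andbT.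
  by apply/eqP => /L_eq1 /AW.
have Lc0 : 0 <= L c by case/andP: (L01 c).
exists ((1 + L c) / 2); split; first by apply/andP; split; lra.
move=> x /= ax; apply: WV; apply: contrapT => /cmax; lra.
Qed.

End LyapunovProperties.

Theorem corollary4p11 (R : realType) (X : metricType R)
  (cX : compact [set: X]) (H : hybrid_system X) (A B : set X)
  (hAB : hybrid_attractor_repeller_pair H A B) :
  exists L : X -> R,
    [/\ continuous L,
        (forall x, 0 <= L x <= 1),
        B = L @^-1` [set 0],
        A = L @^-1` [set 1] &
        forall x y : X,
          (phiC_I H `|` chain_rel (hybrid_rel H)) (x, y) -> x <> y ->
          L x <= L y /\ (L y = L x -> (A x /\ A y) \/ (B x /\ B y))] /\
    [/\ Lyapunov_function (chain_rel (hybrid_rel H)) L,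
        critical_points (chain_rel (hybrid_rel H)) L = A `|` B,
        (forall a : R, 0 < a < 1 ->
          inward H [set x | a <= L x] /\
          associated_attractor H [set x | a <= L x] = A) &
        forall V : set X, set_nbhs A V ->
          exists a : R, 0 < a < 1 /\ [set x | a <= L x] `<=` V].
Proof.
have cH := @closed_hybrid_rel R X cX H.
have iA : increasing_set (hybrid_preorder H) A.
  split; first exact: attractor_closed hAB.
  by move=> x y Ax; exact: (hybrid_preorder_attractor cX hAB Ax).
have decB x y : B y -> hybrid_preorder H (x, y) -> B x.
  by move=> By; exact: (hybrid_preorder_repeller cX hAB By).
have [L [[cL L01 Lhomo LA LB] L1 L0 Lstrict]] := exists_strict_separator cX
  (@closed_hybrid_preorder R X cX H) (hybrid_preorder_refl H)
  (hybrid_preorder_trans cX (H := H)) iA (repeller_closed cX cH hAB) decB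
  (attractor_repeller_disjoint hAB).
have Lstat x y : hybrid_preorder H (x, y) -> x <> y -> L y = L x ->
    (A x /\ A y) \/ (B x /\ B y).
  move=> xy nxy Lyx; have [Ax|nAx] := pselect (A x).
    by left; split => //; exact: iA.2 xy.
  have [By|nBy] := pselect (B y); first by right; split => //; exact: decB xy.
  have nyx : ~ hybrid_preorder H (y, x).
    move=> yx; have xx := hybrid_preorder_antisym cX xy yx nxy.
    have [//|Bx] := chain_recurrent_attractor_repeller cX cH hAB xx.
    by apply: nBy; exact: decB yx.
  by have := Lstrict x y nAx nBy xy nyx; rewrite Lyx ltxx.
have LAP x : A x <-> L x = 1 by split; [exact: LA | exact: L1].
have LBP x : B x <-> L x = 0 by split; [exact: LB | exact: L0].
exists L; split; split => //.
- by apply/seteqP; split=> x /LBP.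
- by apply/seteqP; split=> x /LAP.
- by move=> x y xy nxy; split; [exact: Lhomo | exact: Lstat].
- by split => // x y xy; apply: Lhomo; right.
- exact: critical_points_attractor_repeller.
- move=> a a01; split; first exact: (superlevel_inward cX hAB).
  exact: (superlevel_associated_attractor cX hAB).
- exact: superlevel_sub_nbhs.
Qed.
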